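(* Let $n\ge2$ and $k\ge1$, $D\ge1$ be integers and $\lambda\in(0,1)$. Let $V_1,\dots,V_n$ be i.i.d. uniform on $[0,1]$, let $X\in\mathbb R^{n\times n}$ be given by $X_{i,j}=\lambda\mathbf 1\{|V_i-V_j|\le k/n\}$, and let $Y=X+E$, where $E$ is independent of $(V_1,\dots,V_n)$ and has independent $\mathcal N(0,1)$ entries. Define $$\mathrm{MMSE}_{\le D}=\inf_{f:\ \deg(f)\le D}\mathbb E\big[\|f(Y)-X\|_F^2\big],$$ where the infimum is over all functions $f:\mathbb R^{n\times n}\to\mathbb R^{n\times n}$ each of whose entries is a polynomial of degree at most $D$ in the entries of $Y$. Define $r_0=2\lambda^2(D+1)^4$. If $r_0<1$ and $(2k+1)^2\le n/2$, then $$\mathrm{MMSE}_{\le D}\ \ge\ 2\lambda^2k(n-1)-4\lambda^2k^2\Big(3+\frac{5r_0}{1-r_0}\Big).$$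
   Context: $\|\cdot\|_F$ denotes the Frobenius norm. *)

(* Defs.v *)
From HB Require Import structures.
From mathcomp Require Import all_boot all_order all_algebra.
From mathcomp Require mpoly.
(* The notations of mpoly clash with those of MathComp-Analysis. *)
Import -(notations) mpoly.
From mathcomp Require Import all_classical all_reals all_analysis.

Set Implicit Arguments.
Unset Strict Implicit.
Unset Printing Implicit Defensive.

Import Order.TTheory GRing.Theory Num.Theory.
Import numFieldNormedType.Exports.

Local Open Scope classical_set_scope.
Local Open Scope ring_scope.

Section Independence.
Context d (T : measurableType d) (R : realType) (P : probability T R).

Definition mutually_independent (I : finType) (X : I -> {RV P >-> R}) : Prop :=
  forall (J : {set I}) (B : I -> set R),
    (forall i, i \in J -> measurable (B i)) ->
    P (\bigcap_(i in [set` J]) (X i @^-1` B i)) =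
    (\prod_(i in J) P (X i @^-1` B i))%E.

Definition sigma_of_family (I : Type) (X : I -> {RV P >-> R}) : set (set T) :=
  <<s \bigcup_(i in [set: I]) preimage_set_system setT (X i) measurable >>.

(* The random vectors (X_i)_i and (Z_j)_j are independent of each other; nothing
   is assumed about independence within either family. *)
Definition independent_families (I J : Type)
    (X : I -> {RV P >-> R}) (Z : J -> {RV P >-> R}) : Prop :=
  forall A B : set T, sigma_of_family X A -> sigma_of_family Z B ->
    P (A `&` B) = (P A * P B)%E.

End Independence.

Definition frobenius (R : realType) (m n : nat) (A : 'M[R]_(m, n)) : R :=
  Num.sqrt (\sum_(i < m) \sum_(j < n) A i j ^+ 2).

(* Each entry of f is a polynomial in the n * n entries of the argument, the
   variables being indexed through mxvec; msize p is the total degree plus one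
   (and 0 for p = 0), so the bound says that the degree is at most D. *)
Definition poly_map_le (R : realType) (n D : nat)
    (f : 'M[R]_n -> 'M[R]_n) : Prop :=
  forall i j : 'I_n, exists p : mpoly (n * n) R,
    (msize p <= D.+1)%N /\
    forall Y : 'M[R]_n, f Y i j = meval (fun l => mxvec Y 0 l) p.

Definition mmse_le d (T : measurableType d) (R : realType)
    (P : probability T R) (n D : nat) (X Y : T -> 'M[R]_n) : \bar R :=
  ereal_inf [set 'E_P[fun w => (frobenius (f (Y w) - X w) ^+ 2)%R]%E
            | f in [set f : 'M[R]_n -> 'M[R]_n | poly_map_le D f]].

Definition signal d (T : measurableType d) (R : realType)
    (P : probability T R) (n k : nat) (lambda : R) (V : 'I_n -> {RV P >-> R})
    (w : T) : 'M[R]_n :=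
  \matrix_(i, j) (if `|V i w - V j w| <= k%:R / n%:R then lambda else 0).

Definition noise d (T : measurableType d) (R : realType)
    (P : probability T R) (n : nat) (E : 'I_n * 'I_n -> {RV P >-> R})
    (w : T) : 'M[R]_n :=
  \matrix_(i, j) E (i, j) w.

(* Main.v *)
(* For [i <> j] the signal entry [X_ij] is replaced by a function [g] of the
   noise alone such that [E (f(Y) X_ij) = E (f(Y) g)] for every polynomial [f]
   of degree at most [D]. Then [0 <= E (f(Y) - g)^2] gives
   [E (f(Y) - X_ij)^2 >= E X_ij^2 - E g^2], with no optimisation over [f].
   In the Hermite basis [g] is the sum over [|a| <= D] of
   [kappa_a / a! * He_a(E)], where [kappa_a] is the joint cumulant of [X_ij] and
   [X^a], so that [E g^2 = sum kappa_a^2 / a!]. The cumulant vanishes unless the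
   edges of [a] together with [ij] form a connected graph. Otherwise, if that
   graph has [v] vertices and [|a| = d], then
   [|kappa_a| <= lambda^(d+1) (d+1)^d (2k/n)^(v-1)], because each new vertex of a
   connected graph costs a probability of at most [2k/n]. Since [v <= d + 2] and
   at most [n^(v-2) v^(2d)] multi-indices have these parameters, the hypothesis
   on [(2k+1)^2] makes the sum over [v] geometric of ratio [1/2], and the sum
   over [d] is then dominated by a geometric series of ratio [r0]. *)
Require Import Defs.
From HB Require Import structures.
From mathcomp Require Import all_boot all_order all_algebra.
From mathcomp Require mpoly.
Import -(notations) mpoly.
From mathcomp Require Import all_classical all_reals all_analysis.
From mathcomp Require Import measurable_realfun ring lra zify.

Set Implicit Arguments.
Unset Strict Implicit.
Unset Printing Implicit Defensive.

Import Order.TTheory GRing.Theory Num.Theory.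

Local Open Scope ring_scope.

(** * Cumulants of the signal *)

(** Why such a [g] exists: since [Y = X + E], the addition formula and Hermite orthogonality give [E
    (He_b(Y) He_a(E)) = a! C(b, a) E X^(b - a)]. The conditions on [g] for [|b| <= D] thus form a
    triangular system, which in the unknowns [kappa_a] reads [E (X_ij X^b) = sum over a <= b of C(b,
    a) kappa_a E X^(b - a)]: the recursion of joint cumulants. Cumulants are handled through this
    recursion alone, never through set partitions; their vanishing and their size are both proved by
    induction on the degree. The combinatorics sees the proximity graph only through a set function
    [pr] on edge sets, which loses a factor [c] along a crossing edge and factors over disjoint
    vertex sets. Edges are ordered pairs and loops are allowed, because every entry of [Y] is a
    variable; a loop crosses no cut. The [3] of the bound is [2 + 1]: [2] is the bound on the
    geometric sum of ratio [1/2], which is all that degree zero contributes, and [1] pays for the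
    positions near the ends of [[0, 1]], which lower [E X_ij^2]. *)

Section MultiIndex.
Variables (E : finType) (D : nat).
(** Capping the exponents at [D] makes the type finite and loses no multi-index of degree at most
    [D]. *)
Notation multi := {ffun E -> 'I_D.+1}.
Implicit Types a b : multi.

Definition mdegree a : nat := (\sum_e a e)%N.
Definition msupport a : {set E} := [set e | (0 < a e)%N].
Definition mle b a : bool := [forall e, (b e <= a e)%N].
Definition mbin a b : nat := (\prod_e 'C(a e, b e))%N.
Definition mfact a : nat := (\prod_e (a e)`!)%N.
(** The support of [a - b]: as signal entries are multiples of indicators, [X^(a - b)] depends on
    its exponents only through this set and a power of [lam]. *)
Definition mdiff a b : {set E} := [set e | (b e < a e)%N].

Lemma mle_refl a : mle a a.
Proof. exact/forallP. Qed.

Lemma mle_degree a b : mle b a -> (mdegree b <= mdegree a)%N.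
Proof. by move=> /forallP ba; exact: leq_sum. Qed.

Lemma mlt_degree a b : mle b a -> b != a -> (mdegree b < mdegree a)%N.
Proof.
move=> ba; rewrite ltn_neqAle mle_degree// andbT; apply: contraNneq.
move=> dab; apply/eqP/ffunP => e; apply/val_inj/eqP => /=.
have /forallP ba' := ba.
have : [forall (e | true), b e == a e :> nat].
  by rewrite -(leqif_sum (fun e _ => leqif_eq (ba' e))) -/(mdegree _) dab.
by move=> /forallP/(_ e).
Qed.

Lemma mbin_refl a : mbin a a = 1%N.
Proof. by rewrite /mbin big1// => e _; rewrite binn. Qed.

Lemma mbin_small a b : ~~ mle b a -> mbin a b = 0%N.
Proof.
rewrite negb_forall => /existsP[e]; rewrite -ltnNge => ab.
by rewrite /mbin (bigD1 e)//= bin_small.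
Qed.

Lemma mdiff_refl a : mdiff a a = finset.set0.
Proof. by apply/finset.setP => e; rewrite !inE ltnn. Qed.

(** The binomial theorem in each coordinate, multiplied out; a [b] not below [a] contributes zero
    through [mbin]. *)
Lemma sum_mbin (R : comRingType) (x : R) a :
  \sum_b (mbin a b)%:R * x ^+ mdegree b = (x + 1) ^+ mdegree a.
Proof.
transitivity (\sum_(b : multi) \prod_e ('C(a e, b e)%:R * x ^+ b e)).
  by apply: eq_bigr => b _; rewrite big_split /= natr_prod expr_sum.
rewrite -(bigA_distr_bigA (fun e (k : 'I_D.+1) => 'C(a e, k)%:R * x ^+ k)) /=.
rewrite /mdegree expr_sum; apply: eq_bigr => e _.
rewrite addrC exprDn
  (big_ord_widen D.+1 (fun k => 1 ^+ (a e - k) * x ^+ k *+ 'C(a e, k))).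
  rewrite [RHS]big_mkcond /=; apply: eq_bigr => k _.
  case: ltnP => [_|ak]; first by rewrite expr1n mul1r mulr_natl.
  by rewrite bin_small// mul0r.
exact: ltn_ord.
Qed.

Lemma card_multi_le (S : {set E}) d : (d <= D)%N ->
  (#|[set a : multi | (mdegree a == d) && (msupport a \subset S)]| <= #|S| ^ d)%N.
Proof.
elim: d => [|d IHd] dD.
  rewrite expn0 -(cards1 ([ffun=> ord0] : multi)); apply: subset_leq_card.
  apply/fintype.subsetP => a; rewrite !inE => /andP[/eqP a0 _].
  apply/eqP/ffunP => e; rewrite ffunE; apply: val_inj => /=.
  by apply/eqP; rewrite -leqn0 -a0 /mdegree (bigD1 e)//= leq_addr.
rewrite expnS; apply: leq_trans (leq_mul (leqnn _) (IHd (ltnW dD))).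
rewrite -cardsX.
(* Incrementing one coordinate reaches every multi-index of the next degree. Past [D], [inord] falls
   back to [ord0], which is harmless because only surjectivity is used. *)
pose f (p : E * multi) : multi :=
  [ffun e => if e == p.1 then inord (p.2 e).+1 else p.2 e].
apply: leq_trans (leq_imset_card f _); apply: subset_leq_card.
apply/fintype.subsetP => a; rewrite !inE => /andP[/eqP ad aS].
have [e ae] : exists e, (0 < a e)%N.
  apply/existsP; apply: contraT; rewrite negb_exists => /forallP a0.
  move: ad; rewrite /mdegree big1// => e _.
  by apply/eqP; rewrite -leqn0 leqNgt a0.
pose b : multi := [ffun e' => if e' == e then inord (a e).-1 else a e'].
have be : b e = (a e).-1 :> nat.
  by rewrite ffunE eqxx inordK// (leq_ltn_trans (leq_pred _)).
have bE e' : e' != e -> b e' = a e' by rewrite ffunE => /negbTE ->.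
apply/imsetP; exists (e, b).
  have abd : mdegree a = (mdegree b).+1.
    rewrite /mdegree (bigD1 e)//= [in RHS](bigD1 e)//= be -addSn prednK//.
    by congr addn; apply: eq_bigr => e' e'e; rewrite bE.
  rewrite !inE /= (fintype.subsetP aS) ?inE//= -eqSS -abd ad eqxx /=.
  apply/fintype.subsetP => e'; rewrite inE; have [->|e'e] := eqVneq e' e.
    by rewrite be => ?; apply: (fintype.subsetP aS); rewrite inE.
  by rewrite bE// => ?; apply: (fintype.subsetP aS); rewrite inE.
apply/ffunP => e'; rewrite ffunE /=; case: eqP => [->|/eqP e'e].
  by apply: val_inj; rewrite /= be prednK// inord_val.
by rewrite bE.
Qed.

End MultiIndex.

(** * The cumulant recursion: vanishing and size of the cumulants *)

Section Kappa.
Variables (R : realType) (n D : nat) (lam c : R) (i j : 'I_n).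
Variable pr : {set 'I_n * 'I_n} -> R.
Notation edge := ('I_n * 'I_n)%type.
Notation multi := {ffun edge -> 'I_D.+1}.
Implicit Types (a b : multi) (W U : {set 'I_n}) (S : {set edge}) (e : edge).

Definition inside W e : bool := (e.1 \in W) && (e.2 \in W).
Definition crossing W e : bool := (e.1 \in W) != (e.2 \in W).

(* The signal entry at [e] is [lam] times the indicator of an event [A_e], and
   [pr S] stands for the probability that [A_e] holds for all [e] in [S]. So
   [cross_moment a] is the expectation of [X_(i,j) X^a] and, for [b <= a],
   [diff_moment a b] is that of [X^(a - b)]. *)
Definition cross_moment a : R := lam ^+ (mdegree a).+1 * pr ((i, j) |: msupport a)%SET.
Definition diff_moment a b : R := lam ^+ (mdegree a - mdegree b) * pr (mdiff a b).

(** [m] is fuel: a proper [b] below [a] has smaller degree, so every [m] above the degree of [a]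
    gives the same value. *)
Fixpoint kappa_rec (m : nat) a : R :=
  if m is m'.+1 then
    cross_moment a - \sum_(b | mle b a && (b != a))
             (mbin a b)%:R * kappa_rec m' b * diff_moment a b
  else 0.

(* The joint cumulant of [X_(i,j)] and [X^a], characterised by [cross_moment_kappa]. *)
Definition kappa a : R := kappa_rec (mdegree a).+1 a.

Lemma kappa_recE m a : (mdegree a < m)%N -> kappa_rec m a = kappa a.
Proof.
suff H m' : (mdegree a < m)%N -> (mdegree a < m')%N ->
    kappa_rec m a = kappa_rec m' a by move=> am; exact: H.
elim: m m' a => [//|m IHm] [//|m'] a am am' /=.
congr (cross_moment a - _); apply: eq_bigr => b /andP[ba b_a].
have bd := mlt_degree ba b_a.
by rewrite (IHm m') // (leq_trans bd).
Qed.

Lemma kappaE a : kappa a =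
  cross_moment a - \sum_(b | mle b a && (b != a))
           (mbin a b)%:R * kappa b * diff_moment a b.
Proof.
rewrite {1}/kappa /=; congr (cross_moment a - _); apply: eq_bigr => b /andP[ba b_a].
by rewrite kappa_recE// mlt_degree.
Qed.

(** What the cumulant bounds use about the graph; [c] will be [2 * h]. In [pr_grow] the edge reveals
    one position independent of those in [W]; [pr_split] is independence over disjoint vertex
    sets. *)
Hypothesis pr_ge0 : forall S, 0 <= pr S.
Hypothesis pr_set0 : pr finset.set0 = 1.
Hypothesis pr_mono : forall S S', S \subset S' -> pr S' <= pr S.
Hypothesis pr_grow : forall S W e,
  (forall f, f \in S -> inside W f) -> crossing W e ->
  pr (e |: S)%SET <= c * pr S.
Hypothesis pr_split : forall S S' W,
  (forall f, f \in S -> inside W f) -> (forall f, f \in S' -> inside (~: W)%SET f) ->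
  pr (S :|: S')%SET = pr S * pr S'.
Hypotheses (lam_ge0 : 0 <= lam) (c_ge0 : 0 <= c).

Lemma diff_moment_refl a : diff_moment a a = 1.
Proof. by rewrite /diff_moment subnn mdiff_refl pr_set0 mulr1. Qed.

Lemma cross_moment_kappa a :
  cross_moment a = \sum_(b | mle b a) (mbin a b)%:R * kappa b * diff_moment a b.
Proof.
rewrite (bigD1 a) ?mle_refl//= mbin_refl mul1r diff_moment_refl mulr1 kappaE.
by rewrite subrK.
Qed.

(* If no edge of [a] crosses [W], the recursion for [kappa a] restricted to the
   multi-indices living inside [W] already accounts for the whole of [cross_moment a],
   since the part of [a] outside [W] factors out. *)
Lemma kappa_split a W : i \in W -> j \in W ->
  (forall e, e \in msupport a -> ~~ crossing W e) ->
  (exists2 e, e \in msupport a & ~~ inside W e) -> kappa a = 0.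
Proof.
move=> iW jW.
have [m] := ubnP (mdegree a); elim: m a => [//|m IHm] a; rewrite ltnS => am.
move=> across [e0 e0a e0W].
have outE e : e \in msupport a -> ~~ inside W e -> inside (~: W)%SET e.
  move=> /across; rewrite /crossing /inside !inE negbK => /eqP ->.
  by case: (_ \in W).
pose a1 : multi := [ffun e => if inside W e then a e else ord0].
have a1E e : inside W e -> a1 e = a e by rewrite ffunE => ->.
have a1F e : ~~ inside W e -> a1 e = 0%N :> nat by rewrite ffunE => /negbTE ->.
have a1a : mle a1 a.
  by apply/forallP => e; rewrite ffunE; case: ifP.
have da1 := mle_degree a1a.
pose Sout := [set e in msupport a | ~~ inside W e]%SET.
have Sout_out f : f \in Sout -> inside (~: W)%SET f.
  by rewrite inE => /andP[fa fW]; exact: outE.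
rewrite kappaE; apply/eqP; rewrite subr_eq0; apply/eqP.
have -> : cross_moment a =
    cross_moment a1 * (lam ^+ (mdegree a - mdegree a1) * pr Sout).
  rewrite /cross_moment mulrACA -exprD addSn subnKC//; congr (_ * _).
  rewrite -(@pr_split _ _ W) => [|f|//]; last first.
    rewrite !inE => /predU1P[->|]; first by rewrite /inside /= iW jW.
    by apply: contraTT => /a1F ->.
  congr pr; apply/finset.setP => e; rewrite !inE; case: (_ == _) => //=.
  by case: (boolP (inside W e)) => eW;
    rewrite ?(a1E _ eW) ?(a1F _ eW) ?andbF ?andbT ?orbF.
rewrite cross_moment_kappa mulr_suml.
(* A [b] not below [a1] has an edge outside [W] and still none crossing it, so its cumulant vanishes
   by induction. The other terms are those of [cross_moment a1], all carrying the same outside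
   factor. *)
rewrite [RHS](bigID (fun b => mle b a1)) /= [X in _ = _ + X]big1 ?addr0; last first.
  move=> b /andP[/andP[ba b_a]]; rewrite negb_forall => /existsP[e].
  rewrite -ltnNge => a1b.
  have be : e \in msupport b by rewrite inE (leq_ltn_trans _ a1b).
  have eW : ~~ inside W e.
    apply: contraTN a1b => /a1E ->; rewrite -leqNgt.
    by have /forallP := ba.
  rewrite (IHm b) ?mulr0 ?mul0r//.
  - by apply: leq_trans am; exact: mlt_degree.
  - move=> f; rewrite inE => bf; apply: across; rewrite inE.
    by apply: leq_trans bf _; have /forallP := ba.
  - by exists e.
(* The recursion for [a] omits [b = a], yet no [b] below [a1] is lost: the edge [e0] separates [a1]
   from [a]. *)
apply: eq_big => [b|b ba1].
  apply/idP/idP => [ba1|/andP[//]]; rewrite ba1 andbT; apply/andP; split.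
    apply/forallP => e; apply: leq_trans (forallP a1a e).
    by have /forallP := ba1.
  apply: contraTneq ba1 => ->; rewrite negb_forall; apply/existsP; exists e0.
  by rewrite a1F// -ltnNge; move: e0a; rewrite inE.
have b0 e : ~~ inside W e -> b e = 0%N :> nat.
  move=> /a1F a10; apply/eqP; rewrite -leqn0 -a10.
  by have /forallP := ba1.
have db := mle_degree ba1.
have -> : mbin a b = mbin a1 b.
  apply: eq_bigr => e _; case: (boolP (inside W e)) => eW.
    by rewrite a1E.
  by rewrite b0// !bin0.
rewrite -[LHS]mulrA; congr (_ * kappa b * _).
rewrite /diff_moment mulrACA -exprD; congr (_ * _).
  by rewrite addnC addnBA// subnK.
rewrite -(@pr_split _ _ W) => [|f|//]; last first.
  by rewrite inE => ab; apply: contraTT ab => /a1F ->.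
congr pr; apply/finset.setP => e; rewrite !inE.
by case: (boolP (inside W e)) => eW;
  rewrite ?(a1E _ eW) ?(a1F _ eW) ?(b0 _ eW) ?andbF ?andbT ?orbF.
Qed.

(** Induction along a spanning forest rooted in [W]: while [U] is not exhausted, some edge crosses
    the current set, and its new endpoint is added. It serves both to bound probabilities and to
    count vertices. *)
Lemma grow_ind (Q : {set 'I_n} -> Prop) S W U : W \subset U ->
  (forall W', W \subset W' -> W' \proper U ->
    exists e, [/\ e \in S, crossing W' e & inside U e]) ->
  Q W ->
  (forall W' e u, W \subset W' -> e \in S -> crossing W' e -> u \notin W' ->
    inside (u |: W')%SET e -> Q W' -> Q (u |: W')%SET) ->
  Q U.
Proof.
move=> WU conn QW grow.
suff H W' : W \subset W' -> W' \subset U -> Q W' -> Q U by exact: H QW.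
have [m] := ubnP (#|U| - #|W'|)%N; elim: m W' => [//|m IHm] W'.
rewrite ltnS => W'm WW' W'U QW'.
have [UW'|UW'] := boolP (U \subset W').
  by have -> : U = W' by apply/eqP; rewrite finset.eqEsubset UW' W'U.
have [|e [eS eW' eU]] := conn _ WW'; first by rewrite properE W'U.
have [u [uW' uU ue]] :
    exists u, [/\ u \notin W', u \in U & inside (u |: W')%SET e].
  move: eW' eU; rewrite /crossing /inside => + /andP[e1 e2].
  have [e1W|e1W] := boolP (e.1 \in W'); have [e2W|e2W] := boolP (e.2 \in W') => // _.
    by exists e.2; split => //; rewrite !inE eqxx e1W orbT.
  by exists e.1; split => //; rewrite !inE eqxx e2W orbT.
apply: (IHm (u |: W')%SET).
- have : (#|(u |: W')%SET| <= #|U|)%N.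
    by apply: subset_leq_card; rewrite finset.subUset finset.sub1set uU.
  rewrite cardsU1 uW' add1n; move: W'm.
  by move: #|U| #|W'| => x y; clear; lia.
- exact: fintype.subset_trans WW' (finset.subsetUr _ _).
- by rewrite finset.subUset finset.sub1set uU.
- exact: (grow _ e).
Qed.

(** Each added vertex costs a factor [c]. The invariant keeps only the edges inside the current set,
    so that the next edge crosses a set containing all the others, as [pr_grow] requires. *)
Lemma pr_le_exp S W U : W \subset U ->
  (forall W', W \subset W' -> W' \proper U ->
    exists e, [/\ e \in S, crossing W' e & inside U e]) ->
  pr S <= c ^+ (#|U| - #|W|).
Proof.
move=> WU conn.
pose Q W' := pr [set e in S | inside W' e]%SET <= c ^+ (#|W'| - #|W|).
suff : Q U.
  apply: le_trans; apply: pr_mono.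
  by apply/fintype.subsetP => e; rewrite !inE => /andP[].
apply: (@grow_ind Q S W U WU conn) => [|W' e u WW' eS eW' uW' ue QW'].
  by rewrite /Q subnn expr0 -pr_set0; apply: pr_mono; exact: finset.sub0set.
rewrite /Q cardsU1 uW' add1n subSn ?subset_leq_card// exprS.
apply: (@le_trans _ _ (c * pr [set e in S | inside W' e]%SET)); last first.
  by rewrite ler_wpM2l.
apply: le_trans (pr_grow (W := W') (e := e) _ eW'); last first.
  by move=> f; rewrite inE => /andP[].
apply: pr_mono; apply/fintype.subsetP => f; rewrite !inE => /predU1P[->|].
  by rewrite eS.
move=> /andP[-> /andP[f1 f2]] /=.
by rewrite /inside !inE f1 f2 !orbT.
Qed.

Definition vertices a : {set 'I_n} :=
  [set x | [|| x == i, x == j |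
    [exists e in msupport a, (x == e.1) || (x == e.2)]]]%SET.

(** Connectivity of [a] together with the edge [ij], phrased by cuts that do not separate [i] from
    [j]; its negation supplies exactly the set [W] of [kappa_split]. *)
Definition joined a : bool :=
  [forall W : {set 'I_n}, [&& i \in W, j \in W & ~~ (msupport a \subset inside W)]
    ==> ~~ [disjoint msupport a & crossing W]].

Lemma joinedP a W : joined a -> i \in W -> j \in W ->
  (exists2 e, e \in msupport a & ~~ inside W e) ->
  exists2 e, e \in msupport a & crossing W e.
Proof.
move=> /forallP/(_ W) + iW jW [e ea eW]; rewrite iW jW /=.
have -> : ~~ (msupport a \subset inside W).
  by apply/subsetPn; exists e.
by move=> /pred0Pn[f /andP[fa fW]]; exists f.
Qed.

Lemma kappa_not_joined a : ~~ joined a -> kappa a = 0.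
Proof.
rewrite negb_forall => /existsP[W].
rewrite negb_imply negbK => /andP[/and3P[iW jW /subsetPn[e ea eW]] across].
apply: (kappa_split iW jW) => [f fa|]; last by exists e.
by rewrite -[X in ~~ X]/(f \in crossing W) (disjointFr across fa).
Qed.

Lemma i_vertices a : i \in vertices a. Proof. by rewrite inE eqxx. Qed.
Lemma j_vertices a : j \in vertices a. Proof. by rewrite inE eqxx orbT. Qed.

Lemma inside_vertices a e : e \in msupport a -> inside (vertices a) e.
Proof.
move=> ea; rewrite /inside !inE; apply/andP; split; apply/or3P; apply: Or33;
  by apply/exists_inP; exists e; rewrite // eqxx ?orbT.
Qed.

Lemma joined_grow a W : joined a -> i \in W -> j \in W ->
  W \proper vertices a ->
  exists e, [/\ e \in msupport a, crossing W e & inside (vertices a) e].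
Proof.
move=> ca iW jW /properP[_ [x xa xW]].
suff /(joinedP ca iW jW)[e ea eW] : exists2 e, e \in msupport a & ~~ inside W e.
  by exists e; split => //; exact: inside_vertices.
move: xa; rewrite inE => /or3P[/eqP xi|/eqP xj|/exists_inP[e ea xe]].
- by rewrite xi iW in xW.
- by rewrite xj jW in xW.
exists e => //; rewrite /inside negb_and.
by case/orP: xe => /eqP <-; rewrite xW ?orbT.
Qed.

(** Growing from [i] and [j], every new vertex brings a new edge: the crossing edge was not inside
    the old set and is inside the new one. *)
Lemma card_vertices a : joined a -> (#|vertices a| <= mdegree a + 2)%N.
Proof.
move=> ca.
pose Q W := (#|W| <= #|[set e in msupport a | inside W e]%SET| + 2)%N.
have ij_a : [set i; j]%SET \subset vertices a.
  by apply/fintype.subsetP => x; rewrite !inE => /orP[]->; rewrite ?orbT.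
have : Q (vertices a).
  apply: (@grow_ind Q (msupport a) _ _ ij_a) =>
    [W' ijW' W'a||W' e u WW' ea eW' uW' ue QW'].
  - by apply: joined_grow => //; apply: (fintype.subsetP ijW');
      rewrite !inE eqxx ?orbT.
  - by rewrite /Q cards2 (leq_trans _ (leq_addl _ 2))//; case: (i != j).
  rewrite /Q cardsU1 uW' add1n.
  have : (#|e |: [set f in msupport a | inside W' f]|%SET <=
      #|[set f in msupport a | inside (u |: W') f]%SET|)%N.
    apply: subset_leq_card; apply/fintype.subsetP => f.
    rewrite !inE => /predU1P[->|/andP[-> /andP[f1 f2]]].
      by rewrite ue andbT; move: ea; rewrite inE.
    by rewrite /inside !inE f1 f2 !orbT.
  rewrite cardsU1.
  have -> : e \notin [set f in msupport a | inside W' f]%SET.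
    rewrite !inE negb_and; apply/orP; right.
    by move: eW'; rewrite /crossing /inside; do 2 case: (_ \in _).
  by rewrite /= add1n -(leq_add2r 2) addSn; exact: leq_ltn_trans QW'.
move=> /leq_trans; apply; rewrite leq_add2r.
apply: (@leq_trans #|msupport a|).
  by apply: subset_leq_card; apply/fintype.subsetP => e; rewrite !inE => /andP[].
rewrite -sum1_card /mdegree big_mkcond /=; apply: leq_sum => e _.
by rewrite inE; case: ltnP.
Qed.

Lemma cross_moment_ge0 a : 0 <= cross_moment a.
Proof. by rewrite mulr_ge0 ?exprn_ge0. Qed.

Lemma diff_moment_ge0 a b : 0 <= diff_moment a b.
Proof. by rewrite mulr_ge0 ?exprn_ge0. Qed.

(** Growth starts from [i] alone. As long as [j] is missing, the pair [(i, j)], which belongs to the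
    event, is itself a crossing edge; hence the exponent is the number of vertices minus one. *)
Lemma cross_moment_le a : i != j -> joined a ->
  cross_moment a <= lam ^+ (mdegree a).+1 * c ^+ #|vertices a|.-1.
Proof.
move=> ij ca; rewrite ler_wpM2l ?exprn_ge0// -subn1 -(cards1 i).
apply: pr_le_exp => [|W iW Wa]; first by rewrite finset.sub1set i_vertices.
have {}iW : i \in W by rewrite -finset.sub1set.
have [jW|jW] := boolP (j \in W).
  have [e [ea eW eU]] := joined_grow ca iW jW Wa.
  by exists e; rewrite finset.in_setU ea orbT.
exists (i, j); rewrite setU11 /crossing /= iW (negbTE jW) /inside /=.
by rewrite i_vertices j_vertices.
Qed.

Lemma vertices_mono a b : mle b a -> vertices b \subset vertices a.
Proof.
move=> /forallP ba; apply/fintype.subsetP => x.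
rewrite !inE => /or3P[->|->|/exists_inP[e eb xe]]; rewrite ?orbT//.
apply/or3P/Or33/exists_inP; exists e => //.
by move: eb; rewrite !inE => /leq_trans; apply.
Qed.

(** Growth starts from the vertices of [b]. An edge crossing a larger set cannot belong to [b],
    whose edges all lie inside, so it survives in [mdiff a b]. *)
Lemma diff_moment_le a b : mle b a -> joined a ->
  diff_moment a b <= lam ^+ (mdegree a - mdegree b) *
    c ^+ (#|vertices a| - #|vertices b|).
Proof.
move=> ba ca; rewrite ler_wpM2l ?exprn_ge0//.
apply: pr_le_exp => [|W bW Wa]; first exact: vertices_mono.
have iW : i \in W by apply: (fintype.subsetP bW); exact: i_vertices.
have jW : j \in W by apply: (fintype.subsetP bW); exact: j_vertices.
have [e [ea eW eU]] := joined_grow ca iW jW Wa.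
exists e; split => //; rewrite inE.
suff -> : b e = 0%N :> nat by move: ea; rewrite inE.
apply/eqP; rewrite -leqn0 leqNgt; apply: contraTN eW => be.
have : inside (vertices b) e by apply: inside_vertices; rewrite inE.
move=> /andP[/(fintype.subsetP bW) e1 /(fintype.subsetP bW) e2].
by rewrite /crossing e1 e2.
Qed.

(** In each term of the recursion the powers of [lam] and [c] from [kappa b] and [diff_moment a b]
    recombine into the factor [L] of [a]. What remains is numerical: [(|b| + 1)^|b| <= |a|^|b|] for
    proper [b], and the binomial theorem sums [C(a, b) |a|^|b|] to [(|a| + 1)^|a|]. *)
Lemma kappa_le a : i != j -> `|kappa a| <=
  lam ^+ (mdegree a).+1 * (mdegree a).+1%:R ^+ mdegree a * c ^+ #|vertices a|.-1.
Proof.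
move=> ij.
have [m] := ubnP (mdegree a); elim: m a => [//|m IHm] a; rewrite ltnS => am.
have [ca|/kappa_not_joined ->] := boolP (joined a); last first.
  by rewrite normr0 !mulr_ge0 ?exprn_ge0.
pose L := lam ^+ (mdegree a).+1 * c ^+ #|vertices a|.-1.
have L0 : 0 <= L by rewrite mulr_ge0 ?exprn_ge0.
have step b : mle b a && (b != a) ->
    `|(mbin a b)%:R * kappa b * diff_moment a b| <=
    (mbin a b)%:R * (mdegree a)%:R ^+ mdegree b * L.
  move=> /andP[ba b_a]; have ltd := mlt_degree ba b_a.
  rewrite 2!normrM normr_nat -!mulrA ler_wpM2l//.
  rewrite (ger0_norm (diff_moment_ge0 _ _)).
  apply: le_trans (ler_pM _ _ (IHm b (leq_trans ltd am)) (diff_moment_le ba ca)) _ => //.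
    exact: diff_moment_ge0.
  have -> : lam ^+ (mdegree b).+1 * (mdegree b).+1%:R ^+ mdegree b *
      c ^+ #|vertices b|.-1 * (lam ^+ (mdegree a - mdegree b) *
      c ^+ (#|vertices a| - #|vertices b|)) =
      (mdegree b).+1%:R ^+ mdegree b * L.
    rewrite /L; have -> : (mdegree a).+1 = ((mdegree b).+1 + (mdegree a - mdegree b))%N.
      by rewrite addSn (subnKC (ltnW ltd)).
    have -> : #|vertices a|.-1 = (#|vertices b|.-1 + (#|vertices a| - #|vertices b|))%N.
      have vb : (0 < #|vertices b|)%N by apply/card_gt0P; exists i; exact: i_vertices.
      have := subset_leq_card (vertices_mono ba); move: vb.
      by case: #|_| => // x _; case: #|_| => // y xy; rewrite subSS subnKC.
    rewrite !exprD; move: (lam ^+ _.+1) (lam ^+ (_ - _)) (c ^+ _.-1).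
    by move: (c ^+ (_ - _)) (_ ^+ mdegree b) => *; ring.
  by rewrite ler_wpM2r// lerXn2r ?nnegrE// ler_nat.
rewrite kappaE (le_trans (ler_normB _ _))// (ger0_norm (cross_moment_ge0 _)).
rewrite mulrAC -/L [leRHS]mulrC.
apply: (@le_trans _ _ (L + \sum_(b | mle b a && (b != a))
    (mbin a b)%:R * (mdegree a)%:R ^+ mdegree b * L)).
  apply: lerD; first exact: cross_moment_le.
  by apply: le_trans (ler_norm_sum _ _ _) _; exact: ler_sum.
rewrite -mulr_suml -[X in X + _]mul1r -mulrDl ler_wpM2r//.
have -> : (mdegree a).+1%:R ^+ mdegree a =
    \sum_(b | mle b a) (mbin a b)%:R * (mdegree a)%:R ^+ mdegree b :> R.
  rewrite -natr1 -sum_mbin (bigID (fun b => mle b a)) /= [X in _ + X]big1 ?addr0//.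
  by move=> b ba; rewrite mbin_small// mul0r.
(* The term [b = a], absent from the recursion, is [|a|^|a| >= 1] and pays for [cross_moment a]; in
   degree zero it is [0^0 = 1]. *)
rewrite [leRHS](bigD1 a) ?mle_refl//= mbin_refl mul1r lerD2r.
by case: (mdegree a) => [|d]; rewrite ?expr0// exprn_ege1// ler1n.
Qed.

End Kappa.

(** * Counting multi-indices by degree and number of vertices *)

Section Counting.
Variables (n D : nat) (i j : 'I_n).
Hypothesis ij : i != j.
Notation edge := ('I_n * 'I_n)%type.
Notation multi := {ffun edge -> 'I_D.+1}.
Implicit Types (a : multi) (W : {set 'I_n}).

Lemma ffact_le_exp p m : (p ^_ m <= p ^ m)%N.
Proof.
elim: m => [|m IHm]; first by rewrite ffactn0.
by rewrite ffactnSr expnSr leq_mul// leq_subr.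
Qed.

Lemma bin_le_exp p m : ('C(p, m) <= p ^ m)%N.
Proof.
by rewrite (leq_trans _ (ffact_le_exp _ _))// -bin_ffact leq_pmulr// fact_gt0.
Qed.

Lemma card_supersets2 m :
  (#|[set W : {set 'I_n} | [&& i \in W, j \in W & #|W| == m.+2]]%SET| <= n ^ m)%N.
Proof.
set A := [set W | _]%SET.
apply: leq_trans (bin_le_exp n m).
rewrite -[in leqRHS](card_ord n) -card_draws.
pose f W := (W :\ i :\ j)%SET.
rewrite -(card_in_imset (f := f) (D := mem A)); last first.
  have fK W : W \in A -> (i |: (j |: f W))%SET = W.
    rewrite inE => /and3P[iW jW _].
    by rewrite /f finset.setD1K ?finset.setD1K// !inE eq_sym ij.
  by move=> W1 W2 /fK {2}<- /fK {2}<- ->.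
apply: subset_leq_card; apply/fintype.subsetP => _ /imsetP[W + ->].
rewrite !inE => /and3P[iW jW /eqP Wm].
rewrite /f.
have := cardsD1 i W; have := cardsD1 j (W :\ i)%SET.
by rewrite iW !inE eq_sym ij jW Wm /= !add1n => -> [] [->].
Qed.

(** The vertex set is chosen first, among those containing [i] and [j]; then [d] ordered pairs are
    chosen inside it, whence the square. *)
Lemma card_vertices_eq d m : (d <= D)%N ->
  (#|[set a : multi | (mdegree a == d) && (#|vertices i j a| == m.+2)]%SET|
    <= n ^ m * (m.+2 ^ 2) ^ d)%N.
Proof.
move=> dD; rewrite -sum1_card.
pose A := [set W : {set 'I_n} | [&& i \in W, j \in W & #|W| == m.+2]]%SET.
rewrite (partition_big (vertices i j) (mem A)) /=; last first.
  by move=> a; rewrite !inE => /andP[_ ->]; rewrite !eqxx ?orbT.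
apply: (@leq_trans (\sum_(W in A) (m.+2 ^ 2) ^ d)%N); last first.
  by rewrite sum_nat_const leq_mul2r card_supersets2 orbT.
apply: leq_sum => W; rewrite inE => /and3P[_ _ /eqP Wm].
rewrite -Wm expnS expn1 -cardsX; apply: leq_trans (card_multi_le _ dD).
rewrite sum1_card; apply: subset_leq_card; apply/fintype.subsetP => a.
rewrite unfold_in /= inE => /andP[/andP[ad _] /eqP <-]; rewrite inE ad /=.
apply/fintype.subsetP => e ea; rewrite inE.
exact: (inside_vertices i j ea).
Qed.

(** Multi-indices are sorted by their number [m + 2] of vertices. For [y = c^2] the factor [(n y)^m]
    will be geometric. *)
Lemma sum_vertices_le (R : realType) (y : R) d : 0 <= y -> (d <= D)%N ->
  \sum_(a : multi | (mdegree a == d) && joined i j a) y ^+ #|vertices i j a|.-1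
  <= y * \sum_(m < d.+1) (n%:R * y) ^+ m * (m.+2%:R ^+ 2) ^+ d.
Proof.
move=> y0 dD.
pose G (m : 'I_d.+1) a := (mdegree a == d) && (#|vertices i j a| == m.+2).
(* Connectivity serves only to bound [m] by [d]; the classes being counted forget it. *)
apply: (@le_trans _ _ (\sum_(m < d.+1) \sum_(a | G m a) y ^+ m.+1)).
  rewrite (exchange_big_dep (fun a => mdegree a == d)) /=; last first.
    by move=> m a _ /andP[].
  rewrite [leRHS](bigID (joined i j)) /= -[leLHS]addr0 lerD//; last first.
    by apply: sumr_ge0 => a _; apply: sumr_ge0 => m _; rewrite exprn_ge0.
  apply: ler_sum => a /andP[/eqP ad ca].
  have v2 : (1 < #|vertices i j a|)%N.
    apply: (@leq_trans #|[set i; j]%SET|); first by rewrite cards2 ij.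
    apply: subset_leq_card.
    by apply/fintype.subsetP => x; rewrite !inE => /orP[]->; rewrite ?orbT.
  have vd := card_vertices ca.
  have vlt : (#|vertices i j a|.-2 < d.+1)%N by rewrite -ad; lia.
  have vE : #|vertices i j a|.-2.+2 = #|vertices i j a| by lia.
  rewrite (bigD1 (Ordinal vlt)) /=; last by rewrite /G ad eqxx /= vE.
  rewrite [X in y ^+ X <= _](_ : _ = #|vertices i j a|.-2.+1); last first.
    by move: v2; case: #|vertices i j a| => [|[]].
  by rewrite lerDl sumr_ge0// => m _; rewrite exprn_ge0.
rewrite mulr_sumr; apply: ler_sum => m _.
rewrite sumr_const -[leLHS]mulr_natr exprS -mulrA ler_wpM2l//.
rewrite exprMn mulrC mulrAC ler_wpM2r ?exprn_ge0//.
rewrite -!natrX -natrM ler_nat.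
by have := card_vertices_eq m dD; rewrite cardsE.
Qed.

End Counting.

(** * The sum of the squared cumulants *)

Section Energy.
Variables (R : realType) (n D : nat) (i j : 'I_n).
Hypothesis ij : i != j.
Notation edge := ('I_n * 'I_n)%type.
Notation multi := {ffun edge -> 'I_D.+1}.
Implicit Types (a : multi).

Lemma geometric_le (r : R) m : 0 <= r < 1 -> \sum_(k < m) r ^+ k <= (1 - r)^-1.
Proof.
move=> /andP[r0 r1]; have r1' : 0 < 1 - r by rewrite subr_gt0.
rewrite -[leRHS]mul1r ler_pdivlMr//.
suff -> : (\sum_(k < m) r ^+ k) * (1 - r) = 1 - r ^+ m.
  by rewrite lerBlDr lerDl exprn_ge0.
by rewrite -opprB mulrN mulrC -subrX1 opprB.
Qed.

(** From [d = 2] on, [(d + 2)^2 <= 2 (d + 1)^2]. This fails at [d = 1], where a constant above [2]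
    is used: [18 <= 40]. *)
Lemma vertex_count_le (d : nat) :
  (0 < d)%N -> 2 * ((d.+2)%:R ^+ 2) ^+ d <= 5 * (2 * (d.+1)%:R ^+ 2) ^+ d :> R.
Proof.
case: d => [//|[_|d _]]; first by rewrite !expr1; lra.
apply: ler_pM => //; first lra.
rewrite lerXn2r ?nnegrE ?mulr_ge0 ?exprn_ge0//.
rewrite -!natrX -natrM ler_nat; lia.
Qed.

(** The factorials are bounded below by [1]. Degree zero contributes at most [2] and degree [d >= 1]
    at most [5 r0^d], in units of [lam^2 c^2]. *)
Lemma kappa_energy (lam c : R) (kap : multi -> R) :
  0 <= lam ->
  (forall a, ~~ joined i j a -> kap a = 0) ->
  (forall a, `|kap a| <= lam ^+ (mdegree a).+1 *
    (mdegree a).+1%:R ^+ mdegree a * c ^+ #|vertices i j a|.-1) ->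
  c ^+ 2 * n%:R <= 1 / 2 ->
  let r0 := 2 * lam ^+ 2 * (D%:R + 1) ^+ 4 in r0 < 1 ->
  \sum_(a | (mdegree a <= D)%N) kap a ^+ 2 / (mfact a)%:R <=
  lam ^+ 2 * c ^+ 2 * (2 + 5 * r0 / (1 - r0)).
Proof.
move=> lam0 kap0 kap_le cn r0 r01.
pose y := c ^+ 2; have y0 : 0 <= y by exact: sqr_ge0.
have ly0 : 0 <= lam ^+ 2 * y by apply: mulr_ge0 => //; exact: sqr_ge0.
have r00 : 0 <= r0 by rewrite /r0 !mulr_ge0 ?exprn_ge0 ?addr_ge0.
have deg_le d : (d <= D)%N ->
    \sum_(a | mdegree a == d) kap a ^+ 2 / (mfact a)%:R <=
    lam ^+ 2 * y * (2 * (lam ^+ 2 * d.+1%:R ^+ 2 * d.+2%:R ^+ 2) ^+ d).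
  move=> dD.
  apply: (@le_trans _ _ (\sum_(a | (mdegree a == d) && joined i j a)
      (lam ^+ d.+1 * d.+1%:R ^+ d) ^+ 2 * y ^+ #|vertices i j a|.-1)).
    rewrite (bigID (joined i j)) /= [X in _ + X]big1 ?addr0; last first.
      by move=> a /andP[_ /kap0 ->]; rewrite expr0n mul0r.
    apply: ler_sum => a /andP[/eqP <- _].
    apply: (@le_trans _ _ (kap a ^+ 2)).
      rewrite ler_piMr ?sqr_ge0// invf_le1 ?ltr0n ?ler1n;
        by rewrite prodn_gt0// => e; exact: fact_gt0.
    rewrite /y -exprM mulnC exprM -exprMn -real_normK ?num_real//.
    by rewrite lerXn2r ?nnegrE// (le_trans _ (kap_le a)).
  rewrite -mulr_sumr.
  have := sum_vertices_le ij y0 dD; move/(ler_wpM2l (sqr_ge0 _))/le_trans; apply.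
  have -> : lam ^+ 2 * y * (2 * (lam ^+ 2 * d.+1%:R ^+ 2 * d.+2%:R ^+ 2) ^+ d) =
      (lam ^+ d.+1 * d.+1%:R ^+ d) ^+ 2 * (y * (2 * (d.+2%:R ^+ 2) ^+ d)).
    rewrite [lam ^+ d.+1]exprS !exprMn -!exprM.
    rewrite !exprM; move: (lam ^+ d) (d.+1%:R ^+ d) (d.+2%:R ^+ d) => *; ring.
  rewrite ler_wpM2l ?sqr_ge0// ler_wpM2l//.
  apply: (@le_trans _ _ (\sum_(m < d.+1) (1 / 2) ^+ m * (d.+2%:R ^+ 2) ^+ d)).
    apply: ler_sum => m _; apply: ler_pM.
    - by apply: exprn_ge0; apply: mulr_ge0.
    - by apply: exprn_ge0; apply: exprn_ge0.
    - have ny : n%:R * y <= 1 / 2 by rewrite mulrC.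
      have ny0 : 0 <= n%:R * y by exact: mulr_ge0.
      by apply: lerXn2r; rewrite ?nnegrE//; lra.
    - apply: lerXn2r; rewrite ?nnegrE ?exprn_ge0//.
      by apply: lerXn2r; rewrite ?nnegrE// ler_nat !ltnS -ltnS.
  rewrite -mulr_suml ler_wpM2r ?exprn_ge0//.
  apply: le_trans (geometric_le _ _) _; first by apply/andP; split; lra.
  by rewrite (_ : (1 - 1 / 2)^-1 = 2 :> R)//; field.
(* [inord] sends degrees above [D] to [0], so the condition on the degree has to stay in each
   class. *)
rewrite (partition_big (fun a => inord (mdegree a) : 'I_D.+1) predT) //=.
rewrite -/y big_ord_recl.
have low : \sum_(a : multi | (mdegree a <= D)%N && (inord (mdegree a) == ord0 :> 'I_D.+1))
    kap a ^+ 2 / (mfact a)%:R <= lam ^+ 2 * y * 2.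
  have := deg_le 0%N (leq0n _); rewrite expr0 mulr1; apply: le_trans.
  rewrite le_eqVlt; apply/orP; left; apply/eqP; apply: eq_bigl => a.
  rewrite -val_eqE /=; have [aD|aD] := leqP (mdegree a) D.
    by rewrite inordK.
  by apply/esym/negbTE; rewrite -lt0n (leq_ltn_trans _ aD).
rewrite mulrDr; apply: lerD low _.
apply: (@le_trans _ _ (\sum_(d < D) lam ^+ 2 * y * (5 * r0 ^+ d.+1))).
  apply: ler_sum => d _.
  apply: (@le_trans _ _ (\sum_(a : multi | mdegree a == d.+1) kap a ^+ 2 / (mfact a)%:R)).
    rewrite le_eqVlt; apply/orP; left; apply/eqP; apply: eq_bigl => a.
    rewrite -val_eqE /=; have [aD|aD] := leqP (mdegree a) D.
      by rewrite inordK.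
    by apply/esym/negbTE; rewrite gtn_eqF// (leq_ltn_trans _ aD).
  apply: le_trans (deg_le _ (ltn_ord d)) _.
  rewrite ler_wpM2l//.
  (* In degree [d + 1], the cumulants give [lam^2 (d + 2)^2] and the count of vertices
     [2 (d + 2)^2], both to the power [d + 1]. Their product is at most [r0]; this is the origin of
     the fourth power in [r0]. *)
  rewrite [(_ * d.+3%:R ^+ 2) ^+ _]exprMn mulrCA; apply: (@le_trans _ _
      ((lam ^+ 2 * d.+2%:R ^+ 2) ^+ d.+1 * (5 * (2 * d.+2%:R ^+ 2) ^+ d.+1))).
    apply: ler_wpM2l; last exact: vertex_count_le.
    by apply: exprn_ge0; rewrite mulr_ge0 ?sqr_ge0.
  rewrite mulrCA -exprMn ler_wpM2l// lerXn2r ?nnegrE ?mulr_ge0 ?sqr_ge0//.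
  have d2 : d.+2%:R <= D%:R + 1 :> R by rewrite natr1 ler_nat ltnS.
  have -> : lam ^+ 2 * d.+2%:R ^+ 2 * (2 * d.+2%:R ^+ 2) =
    2 * lam ^+ 2 * d.+2%:R ^+ 4 by ring.
  apply: ler_wpM2l; first by rewrite mulr_ge0 ?sqr_ge0.
  have D0 : 0 <= D%:R + 1 :> R by rewrite natr1.
  by apply: lerXn2r => //; rewrite nnegrE.
rewrite -mulr_sumr ler_wpM2l//.
rewrite -mulr_sumr -mulrA ler_wpM2l//.
under eq_bigr do rewrite exprS.
by rewrite -mulr_sumr ler_wpM2l// geometric_le// r00.
Qed.

End Energy.

Import numFieldNormedType.Exports.

Local Open Scope classical_set_scope.
Local Open Scope ring_scope.

(** * Independence *)

Section IndependentSystems.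
Context d (T : measurableType d) (R : realType) (P : probability T R).
Local Open Scope ereal_scope.

(** Both sides are finite measures in [A] that agree on a pi-system, so they agree on the
    sigma-algebra it generates. *)
Lemma g_sigma_algebra_indep1 (G : set (set T)) (B : set T) :
  G `<=` measurable -> setI_closed G -> G setT -> measurable B ->
  (forall A, G A -> P (A `&` B) = P A * P B) ->
  forall A, <<s G >> A -> P (A `&` B) = P A * P B.
Proof.
move=> Gm GI GT mB GB A sA.
have PB0 : (0 <= fine (P B))%R by rewrite fine_ge0.
pose m1 := mrestr P mB.
pose m2 := mscale (NngNum PB0) P.
have PBE : (NngNum PB0)%:num%:E = P B by rewrite /= fineK// fin_num_measure.
have m2E C : m2 C = P C * P B by rewrite /m2 /mscale /= PBE muleC.
rewrite -m2E -[LHS]/(m1 A).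
apply: (@g_sigma_algebra_measure_unique _ _ _ G _ (fun=> setT)) => //.
- by rewrite bigcup_const.
- by move=> C GC; rewrite -[RHS]/(m2 C) m2E -GB.
- move=> _; rewrite /m1 /= /mrestr.
  rewrite setTI; apply: le_lt_trans (ltry 1%R); exact: probability_le1.
Qed.

Lemma g_sigma_algebra_indep (G H : set (set T)) :
  G `<=` measurable -> setI_closed G -> G setT ->
  H `<=` measurable -> setI_closed H -> H setT ->
  (forall A B, G A -> H B -> P (A `&` B) = P A * P B) ->
  forall A B, <<s G >> A -> <<s H >> B -> P (A `&` B) = P A * P B.
Proof.
move=> Gm GI GT Hm HI HT GH A B sA sB.
have sGm := smallest_sub (@sigma_algebra_measurable _ T) Gm.
have sHm := smallest_sub (@sigma_algebra_measurable _ T) Hm.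
apply: (g_sigma_algebra_indep1 Gm GI GT) => //; first exact: sHm.
move=> C GC; rewrite setIC muleC.
by apply: (g_sigma_algebra_indep1 Hm HI HT) => // [|D HD];
  [exact: Gm|rewrite setIC muleC GH].
Qed.

End IndependentSystems.

Section IndependentFamily.
Context d (T : measurableType d) (R : realType) (P : probability T R).
Local Open Scope ereal_scope.

(** A pi-system generating the sigma-algebra of the variables indexed by [J], so that product
    formulas checked on it extend. *)
Definition cylinders (I : finType) (X : I -> {RV P >-> R}) (J : {set I}) :
    set (set T) :=
  [set A | exists B : I -> set R, (forall i, measurable (B i)) /\
     A = \bigcap_(i in [set` J]) (X i @^-1` B i)].

Lemma cylinders_measurable (I : finType) (X : I -> {RV P >-> R}) J :
  cylinders X J `<=` measurable.
Proof.
move=> _ [B [mB ->]]; apply: fin_bigcap_measurable => //.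
by move=> i _; exact: measurable_funPTI.
Qed.

Lemma cylindersI (I : finType) (X : I -> {RV P >-> R}) J :
  setI_closed (cylinders X J).
Proof.
move=> _ _ [B [mB ->]] [C [mC ->]]; exists (fun i => B i `&` C i); split.
  by move=> i; exact: measurableI.
by rewrite -bigcapI.
Qed.

Lemma cylindersT (I : finType) (X : I -> {RV P >-> R}) J : cylinders X J setT.
Proof.
exists (fun=> setT); split => //.
by apply/esym; rewrite -subTset => w _ i _.
Qed.

Lemma sub_cylinders (I : finType) (X : I -> {RV P >-> R}) (J : {set I}) i B :
  i \in J -> measurable B -> cylinders X J (X i @^-1` B).
Proof.
move=> iJ mB; exists (fun k => if k == i then B else setT); split.
  by move=> k; case: ifP.
apply/seteqP; split => [w Bw k _|w /(_ i)] /=.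
  by case: eqP => // ->.
by rewrite eqxx; apply.
Qed.

Lemma mutually_independent_cylinders (I : finType) (X : I -> {RV P >-> R})
    (J K : {set I}) : mutually_independent X -> [disjoint J & K]%B ->
  forall A B, <<s cylinders X J >> A -> <<s cylinders X K >> B ->
  P (A `&` B) = P A * P B.
Proof.
move=> indX JK; apply: g_sigma_algebra_indep;
  try exact: cylinders_measurable; try exact: cylindersI; try exact: cylindersT.
move=> _ _ [B [mB ->]] [C [mC ->]].
(* As [J] and [K] are disjoint, the two cylinders glue into one over their union, to which mutual
   independence applies. *)
pose BC i := if i \in J then B i else C i.
have mBC i : measurable (BC i) by rewrite /BC; case: ifP.
have JBC i : i \in J -> BC i = B i by rewrite /BC => ->.
have KBC i : i \in K -> BC i = C i.
  by move=> iK; rewrite /BC (disjointFl JK).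
have -> : \bigcap_(i in [set` J]) (X i @^-1` B i) =
    \bigcap_(i in [set` J]) (X i @^-1` BC i).
  by apply: eq_bigcapr => i /= iJ; rewrite JBC.
have -> : \bigcap_(i in [set` K]) (X i @^-1` C i) =
    \bigcap_(i in [set` K]) (X i @^-1` BC i).
  by apply: eq_bigcapr => i /= iK; rewrite KBC.
have -> : \bigcap_(i in [set` J]) (X i @^-1` BC i) `&`
    \bigcap_(i in [set` K]) (X i @^-1` BC i) =
    \bigcap_(i in [set` J :|: K]) (X i @^-1` BC i).
  have -> : [set` J :|: K] = [set` J] `|` [set` K]; last by rewrite bigcap_setU.
  by apply/seteqP; split => i /=; rewrite !inE => /orP.
rewrite !indX => [|i _|i _|i _] //.
rewrite (eq_bigl [predU J & K]); last by move=> i; rewrite !inE.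
by rewrite bigU.
Qed.

Definition sum_RV (I K : Type) (X : I -> {RV P >-> R}) (Y : K -> {RV P >-> R})
    (s : I + K) : {RV P >-> R} :=
  match s with inl i => X i | inr k => Y k end.

Lemma mutually_independent_sum (I K : finType) (X : I -> {RV P >-> R})
    (Y : K -> {RV P >-> R}) :
  mutually_independent X -> mutually_independent Y ->
  independent_families X Y ->
  mutually_independent (sum_RV X Y).
Proof.
move=> indX indY indXY J B mB.
pose J1 := [set i | inl i \in J]%SET; pose J2 := [set k | inr k \in J]%SET.
have -> : \bigcap_(s in [set` J])
    (sum_RV X Y s @^-1` B s) =
    \bigcap_(i in [set` J1]) (X i @^-1` B (inl i)) `&`
    \bigcap_(k in [set` J2]) (Y k @^-1` B (inr k)).
  apply/seteqP; split => [w Bw|w [BX BY] [i|k] sJ].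
  - by split => [i|k] /=; rewrite inE => sJ; exact: (Bw _ sJ).
  - by apply: BX; rewrite /= inE.
  - by apply: BY; rewrite /= inE.
rewrite indXY; last 2 first.
- pose G := \bigcup_(i in [set: I]) preimage_set_system setT (X i) measurable.
  apply: (@fin_bigcap_measurable _ (g_sigma_algebraType G)) => //.
  move=> i /= iJ; apply: sub_sigma_algebra; exists i => //.
  by exists (B (inl i)); [apply: mB; move: iJ; rewrite inE|rewrite setTI].
- pose G := \bigcup_(i in [set: K]) preimage_set_system setT (Y i) measurable.
  apply: (@fin_bigcap_measurable _ (g_sigma_algebraType G)) => //.
  move=> i /= iJ; apply: sub_sigma_algebra; exists i => //.
  by exists (B (inr i)); [apply: mB; move: iJ; rewrite inE|rewrite setTI].
rewrite (indX J1 (fun i => B (inl i))); last by move=> i; rewrite inE => /mB.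
rewrite (indY J2 (fun k => B (inr k))); last by move=> i; rewrite inE => /mB.
rewrite [RHS]big_sumType /=.
by congr (_ * _); apply: eq_bigl => i; rewrite inE.
Qed.

End IndependentFamily.

Section ProductLaw.
Context d d1 d2 (T : measurableType d) (T1 : measurableType d1)
  (T2 : measurableType d2) (R : realType) (P : probability T R).
Local Open Scope ereal_scope.

Lemma indep_product_law (X : {mfun T >-> T1}) (Y : {mfun T >-> T2}) :
  (forall A B, measurable A -> measurable B ->
    P (X @^-1` A `&` Y @^-1` B) = P (X @^-1` A) * P (Y @^-1` B)) ->
  forall S, measurable S -> (distribution P X \x distribution P Y) S =
    P ((fun w => (X w, Y w)) @^-1` S).
Proof.
move=> ind S mS.
have mXY : measurable_fun setT (fun w => (X w, Y w)).
  by apply: measurable_fun_pair; exact: measurable_funPT.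
pose XY : {mfun T >-> (T1 * T2)%type} := mfun_Sub (mem_set mXY).
rewrite (@product_measure_unique _ _ _ _ _ (distribution P X)
  (distribution P Y) (distribution P XY)) //.
Qed.

End ProductLaw.

(** * Moments and expectations *)

Section FiniteMoments.
Context d (T : measurableType d) (R : realType) (P : probability T R).
Implicit Types U W : T -> R.

(** Asking for all absolute moments gives a class closed under sums and products that contains the
    bounded and the Gaussian variables; integrability of every polynomial expression below follows
    from closure. *)
Definition finite_moments U :=
  measurable_fun setT U /\
  forall k : nat, P.-integrable setT (EFin \o (fun w => `|U w| ^+ k)).

Lemma eq_finite_moments U W : U =1 W -> finite_moments U -> finite_moments W.
Proof. by move=> /funext ->. Qed.

Lemma finite_moments_integrable U :
  finite_moments U -> P.-integrable setT (EFin \o U).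
Proof.
move=> [mU /(_ 1%N)]; apply: le_integrable => //; first exact/measurable_EFinP.
by move=> w _ /=; rewrite lee_fin expr1 normr_id.
Qed.

Lemma finite_moments_le U W c :
  measurable_fun setT U -> finite_moments W ->
  (forall w, `|U w| <= c * `|W w|) -> finite_moments U.
Proof.
move=> mU [mW fW] UW; split => // k.
apply: le_integrable (integrableZl measurableT (c ^+ k) (fW k)) => //.
  by apply/measurable_EFinP/measurable_funX/measurableT_comp.
move=> w _ /=; rewrite lee_fin -exprMn.
have cW : 0 <= c * `|W w| by exact: le_trans (UW w).
rewrite (ger0_norm (exprn_ge0 _ cW)) ger0_norm ?exprn_ge0//.
by rewrite lerXn2r ?nnegrE.
Qed.

Lemma finite_moments_cst c : finite_moments (fun=> c).
Proof.
by split => // k; exact: (finite_measure_integrable_cst P (`|c| ^+ k)).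
Qed.

Lemma finite_moments_bounded U c :
  measurable_fun setT U -> (forall w, `|U w| <= c) -> finite_moments U.
Proof.
move=> mU Uc; apply: (finite_moments_le (c := c) mU (finite_moments_cst 1)).
by move=> w; rewrite normr1 mulr1.
Qed.

(* By [2 |u w|^k <= |u|^(2k) + |w|^(2k)], so that no independence is needed. *)
Lemma finite_momentsM U W :
  finite_moments U -> finite_moments W -> finite_moments (fun w => U w * W w).
Proof.
move=> [mU fU] [mW fW]; split => [|k]; first exact: measurable_funM.
apply: le_integrable (integrableD measurableT (fU (k.*2)%N) (fW (k.*2)%N)) => //.
  by apply/measurable_EFinP/measurable_funX/measurableT_comp/measurable_funM.
move=> w _ /=; rewrite lee_fin normrM exprMn -muln2 !exprM.
set a := `|U w| ^+ k; set b := `|W w| ^+ k.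
have a0 : 0 <= a by rewrite exprn_ge0.
have b0 : 0 <= b by rewrite exprn_ge0.
rewrite !ger0_norm ?addr_ge0 ?mulr_ge0 ?sqr_ge0//.
have := sqr_ge0 (a - b); rewrite sqrrB.
have : 0 <= a * b by rewrite mulr_ge0.
lra.
Qed.

Lemma finite_momentsD U W :
  finite_moments U -> finite_moments W -> finite_moments (fun w => U w + W w).
Proof.
move=> [mU fU] [mW fW]; split => [|k]; first exact: measurable_funD.
have := integrableZl measurableT (2 ^+ k)
  (integrableD measurableT (fU k) (fW k)).
apply: le_integrable => //.
  by apply/measurable_EFinP/measurable_funX/measurableT_comp/measurable_funD.
move=> w _ /=; rewrite lee_fin.
set a := `|U w|; set b := `|W w|.
have a0 : 0 <= a by exact: normr_ge0.
have b0 : 0 <= b by exact: normr_ge0.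
have ab0 : 0 <= a ^+ k + b ^+ k by rewrite addr_ge0 ?exprn_ge0.
rewrite (ger0_norm (mulr_ge0 _ ab0)) ?exprn_ge0// ger0_norm ?exprn_ge0//.
apply: (@le_trans _ _ ((2 * Num.max a b) ^+ k)).
  rewrite lerXn2r ?nnegrE ?mulr_ge0 ?le_max ?a0 ?normr_ge0//.
  rewrite (le_trans (ler_normD _ _))// mulr_natl mulr2n.
  by rewrite lerD// le_max lexx ?orbT.
rewrite exprMn ler_wpM2l ?exprn_ge0//.
by case: (leP a b) => _; rewrite ?lerDl ?lerDr exprn_ge0.
Qed.

Lemma finite_momentsN U : finite_moments U -> finite_moments (fun w => - U w).
Proof.
move=> fU; apply: (finite_moments_le (c := 1) _ fU).
  by apply: measurableT_comp => //; case: fU.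
by move=> w; rewrite normrN mul1r.
Qed.

Lemma finite_moments_sum (I : Type) (s : seq I) (p : pred I) (U : I -> T -> R) :
  (forall i, p i -> finite_moments (U i)) ->
  finite_moments (fun w => \sum_(i <- s | p i) U i w).
Proof.
move=> fU; elim: s => [|i s IHs].
  apply: (eq_finite_moments _ (finite_moments_cst 0)) => w.
  by rewrite big_nil.
case: (boolP (p i)) => pi.
  apply: (eq_finite_moments _ (finite_momentsD (fU i pi) IHs)) => w.
  by rewrite big_cons pi.
by apply: (eq_finite_moments _ IHs) => w; rewrite big_cons (negbTE pi).
Qed.

Lemma finite_moments_prod (I : Type) (s : seq I) (p : pred I) (U : I -> T -> R) :
  (forall i, p i -> finite_moments (U i)) ->
  finite_moments (fun w => \prod_(i <- s | p i) U i w).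
Proof.
move=> fU; elim: s => [|i s IHs].
  apply: (eq_finite_moments _ (finite_moments_cst 1)) => w.
  by rewrite big_nil.
case: (boolP (p i)) => pi.
  apply: (eq_finite_moments _ (finite_momentsM (fU i pi) IHs)) => w.
  by rewrite big_cons pi.
by apply: (eq_finite_moments _ IHs) => w; rewrite big_cons (negbTE pi).
Qed.

Lemma finite_momentsX U k : finite_moments U -> finite_moments (fun w => U w ^+ k).
Proof.
move=> fU; elim: k => [|k IHk].
  exact: (finite_moments_cst 1).
by apply: (eq_finite_moments _ (finite_momentsM fU IHk)) => w; rewrite exprS.
Qed.

Lemma finite_moments_horner U (p : {poly R}) :
  finite_moments U -> finite_moments (fun w => p.[U w]).
Proof.
move=> fU; apply: (eq_finite_moments (fun w => esym (horner_coef p (U w)))).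
apply: finite_moments_sum => i _.
by apply: finite_momentsM; [exact: finite_moments_cst|exact: finite_momentsX].
Qed.

Definition Ex U : R := \int[P]_w U w.

Lemma Ex_cst c : Ex (fun=> c) = c.
Proof. by rewrite /Ex /Rintegral integral_cst//= probability_setT mule1. Qed.

Lemma ExD U W : finite_moments U -> finite_moments W ->
  Ex (fun w => U w + W w) = Ex U + Ex W.
Proof. by move=> fU fW; apply: RintegralD => //; exact: finite_moments_integrable. Qed.

Lemma ExZ c U : finite_moments U -> Ex (fun w => c * U w) = c * Ex U.
Proof. by move=> fU; apply: RintegralZl => //; exact: finite_moments_integrable. Qed.

Lemma Ex_sum (I : Type) (s : seq I) (p : pred I) (U : I -> T -> R) :
  (forall i, p i -> finite_moments (U i)) ->
  Ex (fun w => \sum_(i <- s | p i) U i w) = \sum_(i <- s | p i) Ex (U i).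
Proof.
move=> fU; elim: s => [|i s IHs].
  by rewrite big_nil -[RHS]Ex_cst; congr Ex; apply/funext => w; rewrite big_nil.
rewrite big_cons; case: ifP => pi; last first.
  by rewrite -IHs; congr Ex; apply/funext => w; rewrite big_cons pi.
rewrite -IHs -ExD; [|exact: fU|exact: finite_moments_sum].
by congr Ex; apply/funext => w; rewrite big_cons pi.
Qed.

Lemma Ex_ge0 U : (forall w, 0 <= U w) -> 0 <= Ex U.
Proof. by move=> U0; apply: Rintegral_ge0. Qed.

Lemma Ex_indic (A : set T) : measurable A -> Ex (\1_A) = fine (P A).
Proof. by move=> mA; rewrite /Ex /Rintegral integral_indic// setIT. Qed.

(** The joint law is the product of the marginal laws, and Fubini applies because [U * W], having
    finite moments, is integrable under the joint law. *)
Lemma Ex_indep U W : finite_moments U -> finite_moments W ->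
  (forall A B : set R, measurable A -> measurable B ->
    P (U @^-1` A `&` W @^-1` B) = (P (U @^-1` A) * P (W @^-1` B))%E) ->
  Ex (fun w => U w * W w) = Ex U * Ex W.
Proof.
move=> fU fW ind.
have [mU _] := fU; have [mW _] := fW.
pose X : {mfun T >-> R} := mfun_Sub (mem_set mU).
pose Y : {mfun T >-> R} := mfun_Sub (mem_set mW).
have mXY : measurable_fun setT (fun w => (X w, Y w)).
  by apply: measurable_fun_pair; exact: measurable_funPT.
pose XY : {mfun T >-> (R * R)%type} := mfun_Sub (mem_set mXY).
have law := @indep_product_law _ _ _ _ _ _ _ P X Y ind.
pose f (z : R * R) := (z.1 * z.2)%:E.
have mf : measurable_fun setT f.
  by apply/measurable_EFinP/measurable_funM;
     [exact: measurable_fst|exact: measurable_snd].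
have iUW : P.-integrable setT (f \o XY).
  exact: finite_moments_integrable (finite_momentsM fU fW).
have EXY : (\int[P]_w (U w * W w)%:E = \int[pushforward P XY]_z f z)%E.
  by rewrite integral_pushforward.
have lawE g : (\int[pushforward P XY]_z g z =
    \int[distribution P X \x distribution P Y]_z g z)%E.
  by apply: eq_measure_integral => S mS _; rewrite [RHS]law.
have if_ : (distribution P X \x distribution P Y)%E.-integrable setT f.
  have /integrableP[_] := integrable_pushforward mXY mf iUW measurableT.
  by rewrite lawE => ?; apply/integrableP.
have EY : (\int[distribution P Y]_y y%:E = (Ex W)%:E)%E.
  rewrite integral_pushforward//; last first.
    exact: finite_moments_integrable.
  by rewrite /Ex /Rintegral fineK// integrable_fin_num// finite_moments_integrable.
have iY : (distribution P Y).-integrable setT (EFin : R -> \bar R).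
  by apply: integrable_pushforward => //; exact: finite_moments_integrable.
rewrite {1}/Ex /Rintegral EXY lawE -integral12_prod_meas1//=.
rewrite /fubini_F /f /=.
under eq_integral do under eq_integral do rewrite EFinM.
under eq_integral do rewrite integralZl// EY.
rewrite integral_pushforward//; last 2 first.
- exact/measurable_EFinP/measurable_funM.
- exact: finite_moments_integrable (finite_momentsM fU (finite_moments_cst _)).
rewrite preimage_setT /= integralZr//; last exact: finite_moments_integrable.
by rewrite fineM//; apply: integrable_fin_num => //;
  exact: finite_moments_integrable.
Qed.

End FiniteMoments.

(** * Variables depending on a subfamily of an independent family *)

Section Adapted.
Context d (T : measurableType d) (R : realType) (P : probability T R).
Variables (I : finType) (Z : I -> {RV P >-> R}).
Hypothesis indZ : mutually_independent Z.

(** [T] is re-equipped with the smaller sigma-algebra, so that closure properties of measurable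
    functions apply to adapted ones as they stand. *)
Definition adapted d' (T' : measurableType d') (J : {set I}) (U : T -> T') :=
  measurable_fun setT (U : g_sigma_algebraType (cylinders Z J) -> T').

Lemma g_sigma_cylinders_measurable J : <<s cylinders Z J >> `<=` measurable.
Proof.
apply: smallest_sub; first exact: sigma_algebra_measurable.
exact: cylinders_measurable.
Qed.

Lemma adapted_preimage d' (T' : measurableType d') J (U : T -> T') B :
  adapted J U -> measurable B -> <<s cylinders Z J >> (U @^-1` B).
Proof.
move=> aU mB.
have := aU (@measurableT _ (g_sigma_algebraType (cylinders Z J))) B mB.
by rewrite setTI.
Qed.

Lemma adapted_measurable d' (T' : measurableType d') J (U : T -> T') :
  adapted J U -> measurable_fun setT U.
Proof.
move=> aU _ B mB; rewrite setTI; apply: g_sigma_cylinders_measurable.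
exact: adapted_preimage aU mB.
Qed.

Lemma sub_adapted d' (T' : measurableType d') (J K : {set I}) (U : T -> T') :
  J \subset K -> adapted J U -> adapted K U.
Proof.
move=> JK aU _ B mB; rewrite setTI.
have := adapted_preimage aU mB; apply: sub_sigma_algebra2 => _ [C [mC ->]].
exists (fun i => if i \in J then C i else setT); split.
  by move=> i; case: ifP.
apply/seteqP; split => [w Cw i _ /=|w Cw i iJ].
  by case: ifPn => // iJ; exact: Cw.
by have := Cw i (fintype.subsetP JK i iJ); rewrite /= ifT.
Qed.

Lemma adapted_RV (J : {set I}) i : i \in J -> adapted J (Z i).
Proof.
move=> iJ _ B mB; rewrite setTI; apply: sub_sigma_algebra.
exact: sub_cylinders.
Qed.

Lemma Ex_adapted (J K : {set I}) (U W : T -> R) : [disjoint J & K]%B ->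
  adapted J U -> adapted K W -> finite_moments P U -> finite_moments P W ->
  Ex P (fun w => U w * W w) = Ex P U * Ex P W.
Proof.
move=> JK aU aW fU fW; apply: Ex_indep => // A B mA mB.
by apply: (mutually_independent_cylinders indZ JK); exact: adapted_preimage.
Qed.

(** By induction on [r]: the first factor is absorbed into [U] and its index into [J]. *)
Lemma Ex_adapted_prod (r : seq I) (J : {set I}) (U : T -> R) (F : I -> T -> R) :
  uniq r -> (forall i, i \in r -> i \notin J) ->
  adapted J U -> finite_moments P U ->
  (forall i, i \in r -> adapted [set i]%SET (F i)) ->
  (forall i, finite_moments P (F i)) ->
  Ex P (fun w => U w * \prod_(i <- r) F i w) =
  Ex P U * \prod_(i <- r) Ex P (F i).
Proof.
elim: r J U => [|i r IHr] J U /=.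
  move=> _ _ _ _ _ _; rewrite big_nil mulr1; congr Ex; apply/funext => w.
  by rewrite big_nil mulr1.
move=> /andP[ir ur] rJ aU fU aF fF.
have iJ : [disjoint J & [set i]%SET]%B.
  by rewrite disjoint_sym disjoints1 rJ// mem_head.
have aFi : adapted [set i]%SET (F i) by apply: aF; exact: mem_head.
rewrite big_cons mulrA -(Ex_adapted iJ)//.
rewrite -(IHr (i |: J)%SET (fun w => U w * F i w)) //.
- by congr Ex; apply/funext => w; rewrite big_cons mulrA.
- move=> k kr; rewrite !inE negb_or rJ ?in_cons ?kr ?orbT// andbT.
  by apply: contraNneq ir => <-.
- apply: measurable_funM.
    by apply: sub_adapted aU; exact: finset.subsetUr.
  by apply: sub_adapted aFi; exact: finset.subsetUl.
- exact: finite_momentsM.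
- by move=> k kr; apply: aF; rewrite in_cons kr orbT.
Qed.

Lemma measurable_near (U : {RV P >-> R}) (h : R) :
  measurable_fun setT (fun x : R => distribution P U [set y | `|x - y| <= h]).
Proof.
pose f (z : R * R) := `|z.1 - z.2|.
have mf : measurable_fun setT f.
  apply: measurableT_comp => //; apply: measurable_funB.
    exact: measurable_fst.
  exact: measurable_snd.
have mS : measurable (f @^-1` `]-oo, h]%classic).
  by rewrite -[X in measurable X]setTI; exact: mf.
have := @measurable_fun_xsection _ _ _ _ _ (distribution P U) _ mS.
congr measurable_fun; apply/funext => x /=; congr (distribution P U _).
by apply/seteqP; split => y; rewrite /xsection /= inE /= in_itv.
Qed.

(** Given the variables indexed by [J], the variable [Z u] keeps its law and can be integrated out
    first. *)
Lemma near_law (J : {set I}) (A : set T) (w u : I) (h : R) :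
  <<s cylinders Z J >> A -> w \in J -> u \notin J ->
  P (A `&` [set t | `|Z w t - Z u t| <= h]) =
  (\int[P]_(t in A) distribution P (Z u) [set y | (`|Z w t - y| <= h)%R])%E.
Proof.
move=> sA wJ uJ.
have mA : measurable A by exact: g_sigma_cylinders_measurable sA.
have aA : adapted J (\1_A : T -> R).
  by apply: measurable_indic.
have aX : adapted J (fun t => ((\1_A t : R), Z w t)).
  by apply: measurable_fun_pair => //; exact: adapted_RV.
pose X : {mfun T >-> (R * R)%type} := mfun_Sub (mem_set (adapted_measurable aX)).
have JU : [disjoint J & [set u]%SET]%B.
  by rewrite disjoint_sym disjoints1.
(* Membership in [A] is encoded by the value [1] of its indicator, so that the whole event depends
   on one adapted pair and [Z u]. *)
pose S : set ((R * R) * R) := [set z | z.1.1 = 1 /\ `|z.1.2 - z.2| <= h].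
have mS : measurable S.
  apply: measurableI.
    rewrite [X in measurable X](_ : _ = (fst \o fst) @^-1` [set 1])//.
    rewrite -[X in measurable X]setTI.
    have mf : measurable_fun setT (fst \o fst : (R * R) * R -> R).
      by apply: measurableT_comp; exact: measurable_fst.
    exact: mf.
  rewrite -[X in measurable X]setTI.
  pose f (z : (R * R) * R) := `|z.1.2 - z.2|.
  have mf : measurable_fun setT f.
    apply: measurableT_comp => //; apply: measurable_funB.
      by apply: (measurableT_comp measurable_snd); exact: measurable_fst.
    exact: measurable_snd.
  rewrite [X in _ `&` X](_ : _ = f @^-1` `]-oo, h]%classic); first exact: mf.
  by apply/seteqP; split => z /=; rewrite in_itv.
have ind B C : measurable B -> measurable C ->
    P (X @^-1` B `&` Z u @^-1` C) = (P (X @^-1` B) * P (Z u @^-1` C))%E.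
  move=> mB mC; apply: (mutually_independent_cylinders indZ JU).
    exact: adapted_preimage aX mB.
  by apply: adapted_preimage mC; apply: adapted_RV; rewrite inE.
have law := @indep_product_law _ _ _ _ _ _ _ P X (Z u) ind S mS.
transitivity (P ((fun t => (X t, Z u t)) @^-1` S)).
  congr (P _); apply/seteqP; split => t /=.
    by move=> [At ?]; rewrite /S /= indicE mem_set.
  rewrite /S /= indicE; case: (boolP (t \in A)) => [/set_mem At [_ ?]//|_ [/eqP]].
  by rewrite eq_sym oner_eq0.
rewrite -law /product_measure1 ge0_integral_pushforward//=; last 2 first.
  exact: adapted_measurable aX.
  exact: measurable_fun_xsection.
rewrite preimage_setT [RHS]integral_mkcond; apply: eq_integral => t _ /=.
rewrite patchE indicE; case: ifPn => tA.
  congr (distribution P (Z u) _); apply/seteqP; split => y /=.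
    by rewrite /xsection /= inE => -[].
  by rewrite /xsection /= inE.
rewrite [X in distribution _ _ X](_ : _ = set0) ?measure0//.
apply/seteqP; split => y //=; rewrite /xsection /= inE => -[/eqP].
by rewrite eq_sym oner_eq0.
Qed.

End Adapted.

(** * Gaussian moments and Hermite polynomials *)

Section Gaussian.
Context (R : realType).
Local Notation mu := (@lebesgue_measure R).
Local Notation phi := (normal_pdf (0 : R) 1).
Local Notation N := (normal_prob (0 : R) 1).

Lemma normal_pdf01E (x : R) : phi x = normal_peak 1 * expR (- (x ^+ 2 / 2)).
Proof.
rewrite normal_pdfE ?oner_neq0// /normal_fun subr0 expr1n mulNr.
by rewrite mulr2n -[1 + 1]/2%:R.
Qed.

Let mphi : measurable_fun setT (EFin \o phi).
Proof. by apply/measurable_EFinP; exact: measurable_normal_pdf. Qed.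

Let dom : N `<< mu.
Proof. exact: normal_prob_dominates. Qed.

Lemma ae_eq_normal_pdf01 :
  ae_eq mu setT (Radon_Nikodym_SigmaFinite.f N mu) (EFin \o phi).
Proof.
have iRN := Radon_Nikodym_SigmaFinite.f_integrable dom.
apply: integral_ae_eq => //= A _ mA.
by rewrite -(Radon_Nikodym_SigmaFinite.f_integral dom).
Qed.

(** This version for nonnegative functions presupposes no integrability, and so can be used to prove
    that the normal moments are finite. *)
Lemma ge0_integral_normal_prob01 (f : R -> \bar R) :
  measurable_fun setT f -> (forall x, (0 <= f x)%E) ->
  (\int[N]_x f x = \int[mu]_x (f x * (phi x)%:E))%E.
Proof.
move=> mf f0.
rewrite -(Radon_Nikodym_SigmaFinite.change_of_variables dom)//.
have iRN := Radon_Nikodym_SigmaFinite.f_integrable dom.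
apply: ae_eq_integral => //.
- by apply: emeasurable_funM => //; exact: (measurable_int mu).
- exact: emeasurable_funM.
- by apply: ae_eqe_mul2l; exact: ae_eq_normal_pdf01.
Qed.

Lemma integral_normal_prob01 (f : R -> \bar R) : N.-integrable setT f ->
  (\int[N]_x f x = \int[mu]_x (f x * (phi x)%:E))%E.
Proof.
move=> fi; rewrite -(Radon_Nikodym_change_of_variables dom)//.
have mf := measurable_int _ fi.
apply: ae_eq_integral => //.
- exact: emeasurable_funM.
- exact: emeasurable_funM.
- apply: ae_eqe_mul2l; apply: ae_eq_trans ae_eq_normal_pdf01.
  by apply: ae_eq_sym; exact: ae_eq_Radon_Nikodym_SigmaFinite.
Qed.

(** Half of the exponent [x^2 / 2] is kept as a Gaussian of variance [2]; the other half,
    [y = x^2 / 4], absorbs the power. *)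
Lemma normr_exp_le_gauss (k : nat) : exists2 C : R, 0 <= C &
  forall x, `|x| ^+ k * phi x <= C * normal_pdf 0 (Num.sqrt 2) x.
Proof.
have s0 : Num.sqrt 2 != 0 :> R by rewrite gt_eqF// sqrtr_gt0.
(* From [|x|^k <= 1 + |x|^(2k+2) = 1 + 4^(k+1) y^(k+1)] and [exp y >= 1 + y^(k+1) / (k+1)!]; the
   peaks convert between the two normalisations. *)
exists ((1 + k.+1`!%:R * 4 ^+ k.+1) * normal_peak 1 / normal_peak (Num.sqrt 2)).
  by rewrite divr_ge0 ?mulr_ge0 ?normal_peak_ge0 ?addr_ge0 ?exprn_ge0.
move=> x; rewrite normal_pdf01E normal_pdfE//.
rewrite [leRHS]mulrA divfK; last by rewrite gt_eqF// normal_peak_gt0.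
rewrite [leLHS]mulrCA [leRHS]mulrAC [leRHS]mulrC.
rewrite ler_pM2l ?normal_peak_gt0 ?oner_neq0//.
rewrite /normal_fun subr0 sqr_sqrtr// mulNr.
have -> : x ^+ 2 / 2 = x ^+ 2 / (2 *+ 2) + x ^+ 2 / (2 *+ 2) by field.
rewrite opprD expRD; set y := x ^+ 2 / (2 *+ 2).
have y0 : 0 <= y by rewrite divr_ge0 ?sqr_ge0.
rewrite mulrA ler_pM2r ?expR_gt0// expRN ler_pdivrMr ?expR_gt0//.
have := expR_ge1Dxn k y0.
have xk : `|x| ^+ k <= 1 + `|x| ^+ (k.+1).*2.
  have [x1|x1] := leP `|x| 1.
    by rewrite (le_trans (exprn_ile1 _ (normr_ge0 _) x1))// lerDl exprn_ge0.
  rewrite (@le_trans _ _ (`|x| ^+ (k.+1).*2))//; last by rewrite lerDr.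
  by rewrite ler_weXn2l// ?ltW// -addnn addSn ltnW// ltnS leq_addr.
have yE : `|x| ^+ (k.+1).*2 = 4 ^+ k.+1 * y ^+ k.+1.
  rewrite -exprMn /y mulrCA (_ : 4 / (2 *+ 2) = 1 :> R) ?mulr1; last by field.
  by rewrite -muln2 mulnC exprM real_normK// num_real.
move=> H; apply: (le_trans xk); rewrite yE mulrDl mul1r.
have f0 : 0 < k.+1`!%:R :> R by rewrite ltr0n fact_gt0.
apply: lerD.
  by apply: le_trans H; rewrite lerDl divr_ge0 ?exprn_ge0// ltW.
rewrite [_ * 4 ^+ _]mulrC -mulrA ler_wpM2l ?exprn_ge0// mulrC -ler_pdivrMr//.
by apply: le_trans H; rewrite lerDr.
Qed.

Lemma horner_le_gauss (p : {poly R}) : exists2 C : R, 0 <= C &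
  forall x, `|p.[x] * phi x| <= C * normal_pdf 0 (Num.sqrt 2) x.
Proof.
pose C k := sval (cid2 (normr_exp_le_gauss k)).
have C0 k : 0 <= C k by rewrite /C; case: cid2.
have CE k x : `|x| ^+ k * phi x <= C k * normal_pdf 0 (Num.sqrt 2) x.
  by rewrite /C; case: cid2.
exists (\sum_(i < size p) `|p`_i| * C i).
  by apply: sumr_ge0 => i _; rewrite mulr_ge0.
move=> x; rewrite horner_coef !mulr_suml (le_trans (ler_norm_sum _ _ _))//.
apply: ler_sum => i _; rewrite -!mulrA normrM ler_wpM2l//.
by rewrite normrM normrX (ger0_norm (normal_pdf_ge0 _ _ _)).
Qed.

Lemma integrable_horner_gauss (p : {poly R}) :
  mu.-integrable setT (fun x => (p.[x] * phi x)%:E).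
Proof.
have [C C0 pC] := horner_le_gauss p.
have := integrableZl measurableT C (integrable_normal_pdf 0 (Num.sqrt 2)).
apply: le_integrable => //.
  apply/measurable_EFinP/measurable_funM; last exact: measurable_normal_pdf.
  by apply: measurable_poly.
move=> x _ /=; rewrite lee_fin (le_trans (pC x))// ger0_norm//.
by rewrite mulr_ge0// normal_pdf_ge0.
Qed.

Lemma finite_moments_normal_id : finite_moments N (@idfun R).
Proof.
split => [|k]; first exact: measurable_id.
have mk : measurable_fun setT (fun x : R => `|x| ^+ k).
  by apply: measurable_funX; exact: normr_measurable.
have mk' : measurable_fun setT (fun x : R => `|(`|x| ^+ k)%:E|%E).
  by apply: measurableT_comp => //; exact/measurable_EFinP.
apply/integrableP; split; first exact/measurable_EFinP.
rewrite ge0_integral_normal_prob01//.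
have [C C0 pC] := normr_exp_le_gauss k.
have /integrableP[_] :=
  integrableZl measurableT C (integrable_normal_pdf 0 (Num.sqrt 2)).
apply: le_lt_trans; apply: ge0_le_integral => //.
- by move=> x _; rewrite mule_ge0// lee_fin normal_pdf_ge0.
- exact: emeasurable_funM.
- apply: measurableT_comp => //; apply: measurable_funeM.
  by apply/measurable_EFinP; exact: measurable_normal_pdf.
- move=> x _; rewrite -EFinM /= lee_fin.
  rewrite ger0_norm ?exprn_ge0// (ger0_norm (mulr_ge0 C0 _)) ?normal_pdf_ge0//.
Qed.

Lemma Ex_normal_horner (p : {poly R}) :
  Ex N (fun x => p.[x]) = \int[mu]_x (p.[x] * phi x).
Proof.
rewrite /Ex /Rintegral integral_normal_prob01//.
apply: (finite_moments_integrable (P := N)).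
exact: finite_moments_horner finite_moments_normal_id.
Qed.

Let is_derive_phi (x : R) : is_derive x 1 phi (- x * phi x).
Proof.
rewrite (_ : phi = fun y => normal_peak 1 * expR (- (y ^+ 2 / 2))); last first.
  by apply/funext => y; rewrite normal_pdf01E.
apply: trigger_derive.
rewrite !scaler0 add0r /GRing.scale /= !mulr1.
have -> : 2^-1 * (x + x) = x by field.
ring.
Qed.

(** Gaussian integration by parts: [(p phi)' = (p' - x p) phi]. The fundamental theorem is applied
    on growing symmetric intervals, and dominated convergence passes to the limit. *)
Lemma gauss_stein (p : {poly R}) :
  Ex N (fun x => ('X * p).[x]) = Ex N (fun x => p^`().[x]).
Proof.
pose q := p^`() - 'X * p.
pose F x := p.[x] * phi x; pose f x := q.[x] * phi x.
have dF (x : R) : is_derive x 1 F (f x).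
  have H := is_deriveM (is_derive_poly p x) (is_derive_phi x).
  apply: (trigger_derive H).
  rewrite /f /q hornerD hornerN hornerM hornerX /GRing.scale /=; ring.
have cphi : continuous phi by apply: continuous_normal_pdf; exact: oner_neq0.
have cF : continuous F.
  by move=> x; apply: cvgM; [exact: continuous_horner|exact: cphi].
have cf : continuous f.
  by move=> x; apply: cvgM; [exact: continuous_horner|exact: cphi].
have ftc n : (\int[mu]_(x in `[(- n.+1%:R)%R, n.+1%:R]) (f x)%:E =
    (F n.+1%:R - F (- n.+1%:R))%:E)%E.
  rewrite (@continuous_FTC2 _ f F)//.
  - by rewrite (@lt_trans _ _ 0)// ?oppr_lt0 ltr0n.
  - exact: continuous_subspaceT.
  - split => [x _||]; first by have [] := dF x.
      by apply: cvg_at_right_filter; exact: cF.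
    by apply: cvg_at_left_filter; exact: cF.
  - by move=> x _; rewrite derive1E; have [] := dF x.
have iq : mu.-integrable setT (EFin \o f) := integrable_horner_gauss q.
pose f_ n := (EFin \o f) \_ `[(- n.+1%:R)%R, (n.+1%:R : R)].
have mf : measurable_fun setT (EFin \o f) by exact: measurable_int iq.
have mf_ n : measurable_fun setT (f_ n).
  by apply/(measurable_restrictT _ _).1; [|exact: measurable_funTS].
have f_f : {ae mu, forall x, [set: R] x -> f_ n x @[n --> \oo] --> (EFin \o f) x}.
  apply: aeW => x _; apply: cvg_near_cst; near=> n.
  rewrite /f_ patchE ifT// inE /= in_itv /= -ler_norml.
  near: n; exists (Num.truncn `|x|) => // n /= xn.
  by rewrite (le_trans (ltW (truncnS_gt _)))// ler_nat ltnS.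
have f_g : {ae mu, forall x n, [set: R] x -> (`|f_ n x| <= `|(f x)%:E|)%E}.
  apply: aeW => x n _; rewrite /f_ patchE; case: ifP => // _.
  by rewrite abse0.
have [_ _ dct] := @dominated_convergence _ _ _ mu setT measurableT f_
  (EFin \o f) (abse \o (EFin \o f)) mf_ mf f_f (integrable_abse iq) f_g.
have intf_ n : (\int[mu]_x f_ n x = (F n.+1%:R - F (- n.+1%:R))%:E)%E.
  by rewrite -ftc [RHS]integral_mkcond.
(* Since [x p(x) phi(x)] is bounded, [F] is of order [1 / |x|], so the boundary terms are dominated
   by a harmonic sequence. *)
have lim0 : (F n.+1%:R - F (- n.+1%:R)) @[n --> \oo] --> 0.
  have [C C0 CE] := horner_le_gauss ('X * p).
  pose K := C * normal_peak (Num.sqrt 2 : R).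
  have FK x : 0 < `|x| -> `|F x| <= K / `|x|.
    move=> x0; rewrite ler_pdivlMr// -normrM mulrC /F mulrA.
    have := CE x; rewrite hornerM hornerX => /le_trans; apply.
    by rewrite ler_wpM2l// normal_pdf_ub// gt_eqF// sqrtr_gt0.
  have K2 : (2 * K) * @harmonic R n @[n --> \oo] --> (0 : R).
    by rewrite -[X in _ --> X](mulr0 (2 * K)); apply: cvgMr; exact: cvg_harmonic.
  apply/norm_cvg0P.
  apply: (@squeeze_cvgr _ _ _ _ (fun=> 0) (fun n => 2 * K * harmonic n)) => //.
    near=> n; rewrite normr_ge0 /= (le_trans (ler_normB _ _))//.
    have n0 : 0 < n.+1%:R :> R by rewrite ltr0n.
    have := FK n.+1%:R; have := FK (- n.+1%:R).
    rewrite normrN (gtr0_norm n0) => /(_ n0) + /(_ n0).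
    by rewrite /harmonic /= -mulrA mulr_natl mulr2n => h1 h2; exact: lerD.
  exact: cvg_cst.
have : \int[mu]_x f x = 0.
  have intf : (\int[mu]_x (f x)%:E)%E \is a fin_num by exact: integrable_fin_num.
  have cvgf : (fine \o (fun n => \int[mu]_x f_ n x)%E) @ \oo --> \int[mu]_x f x.
    by apply: fine_cvg; rewrite /Rintegral fineK.
  have fE : fine \o (fun n => \int[mu]_x f_ n x)%E =
      fun n => F n.+1%:R - F (- n.+1%:R).
    by apply/funext => n /=; rewrite intf_.
  rewrite fE in cvgf.
  exact: (cvg_unique _ cvgf lim0).
rewrite -Ex_normal_horner => Exq.
have fN r : finite_moments N (fun x : R => (r : {poly R}).[x]).
  exact: finite_moments_horner finite_moments_normal_id.
transitivity (Ex N (fun x => q.[x] + ('X * p).[x])).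
  by rewrite ExD// Exq add0r.
by congr Ex; apply/funext => x; rewrite -hornerD subrK.
Unshelve. all: by end_near. Qed.

End Gaussian.

(** * Hermite polynomials under the standard normal law *)

Section Hermite.
Context (R : realType).

(** The probabilists' Hermite polynomials, in the recursive form that matches Gaussian integration
    by parts. *)
Fixpoint hermite (n : nat) : {poly R} :=
  if n is m.+1 then 'X * hermite m - (hermite m)^`() else 1.

Lemma deriv_hermite n : (hermite n.+1)^`() = n.+1%:R *: hermite n.
Proof.
elim: n => [|n IHn].
  by rewrite /= mulr1 derivB derivX -polyC1 derivC deriv0 subr0 scale1r.
rewrite [hermite n.+2]/= -/(hermite n.+1) derivB derivM derivX mul1r IHn.
rewrite derivZ -scalerAr -addrA -scalerBr.
by rewrite -/(hermite n.+1) -[X in X + _]scale1r -scalerDl -mulrS.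
Qed.

Lemma derivn_hermite n i : (hermite n)^`(i) = (n ^_ i)%:R *: hermite (n - i).
Proof.
elim: i n => [|i IHi] n; first by rewrite ffactn0 scale1r subn0.
case: n => [|n].
  have -> : hermite 0 = 1%:P by rewrite polyC1.
  by rewrite derivnC ffact0n scale0r.
rewrite derivSn deriv_hermite derivnZ IHi scalerA -natrM.
by rewrite ffactnS subSS.
Qed.

Lemma nderivn_hermite n i :
  (hermite n)^`N(i) = 'C(n, i)%:R *: hermite (n - i).
Proof.
have fi : i`!%:R != 0 :> R by rewrite pnatr_eq0 -lt0n fact_gt0.
apply: (scalerI fi); rewrite scalerA -natrM mulnC bin_ffact -derivn_hermite.
by rewrite nderivn_def scaler_nat.
Qed.

Lemma size_hermite_monic n : size (hermite n) = n.+1 /\ hermite n \is monic.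
Proof.
elim: n => [|n [sn mn]]; first by rewrite size_poly1 monic1.
have sX : size ('X * hermite n) = n.+2.
  by rewrite mulrC size_mulX ?sn// -size_poly_eq0 sn.
have sd : (size (- (hermite n)^`())%R < size ('X * hermite n)%R)%N.
  by rewrite size_polyN sX -sn (leq_trans (lt_size_deriv _))// -size_poly_eq0 sn.
by rewrite /= size_polyDl// monicE lead_coefDl// -monicE monicMr// monicX.
Qed.

Lemma size_hermite n : size (hermite n) = n.+1.
Proof. by have [] := size_hermite_monic n. Qed.

(** Taylor expansion at [y]: the normalised [i]-th derivative of [hermite n] is [C(n, i)] times
    [hermite (n - i)], and the sum is then reversed. *)
Lemma hermiteD n (x y : R) : (hermite n).[x + y] =
  \sum_(i < n.+1) 'C(n, i)%:R * x ^+ (n - i) * (hermite i).[y].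
Proof.
rewrite addrC nderiv_taylor; last exact: mulrC.
rewrite size_hermite (reindex_inj rev_ord_inj) /=; apply: eq_bigr => i _.
rewrite nderivn_hermite hornerZ subSS subKn -1?ltnS// bin_sub -1?ltnS//.
by rewrite mulrAC.
Qed.

Lemma hermite_span n (p : {poly R}) : (size p <= n)%N ->
  exists c : nat -> R, p = \sum_(i < n) c i *: hermite i.
Proof.
elim: n p => [|n IHn] p sp.
  by exists (fun=> 0); rewrite big_ord0; apply/eqP; rewrite -size_poly_leq0.
have lc : (hermite n)`_n = 1.
  have [_] := size_hermite_monic n.
  by rewrite monicE lead_coefE size_hermite => /eqP.
have [] := IHn (p - p`_n *: hermite n).
  apply/leq_sizeP => j nj; rewrite coefB coefZ.
  move: nj; rewrite leq_eqVlt => /predU1P[<-|nj].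
    by rewrite lc mulr1 subrr.
  have -> : p`_j = 0 by rewrite nth_default// (leq_trans sp nj).
  have -> : (hermite n)`_j = 0 by rewrite nth_default// size_hermite.
  by rewrite mulr0 subrr.
move=> c pE; exists (fun i => if i == n then p`_n else c i).
rewrite big_ord_recr /= eqxx -[LHS](subrK (p`_n *: hermite n)) pE.
by congr (_ + _); apply: eq_bigr => i _; rewrite ltn_eqF.
Qed.

Local Notation N := (normal_prob (0 : R) 1).

Definition gauss (p : {poly R}) : R := Ex N (fun x => p.[x]).

Let fN (p : {poly R}) : finite_moments N (fun x => p.[x]).
Proof. exact: finite_moments_horner (finite_moments_normal_id R). Qed.

Lemma gaussB p q : gauss (p - q) = gauss p - gauss q.
Proof.
transitivity (Ex N (fun x => p.[x] + -1 * q.[x])).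
  by congr Ex; apply/funext => x; rewrite hornerD hornerN mulN1r.
rewrite ExD// ?ExZ ?mulN1r//.
exact: (finite_momentsM (finite_moments_cst _ _)).
Qed.

Lemma gaussZ c p : gauss (c *: p) = c * gauss p.
Proof.
by rewrite /gauss -ExZ//; congr Ex; apply/funext => x; rewrite hornerZ.
Qed.

Lemma gauss1 : gauss 1 = 1.
Proof.
by rewrite /gauss -[RHS](Ex_cst N); congr Ex;
  apply/funext => x; rewrite hornerE.
Qed.

(** Each integration by parts moves one derivative onto [p]: the part falling on [hermite n] cancels
    against the recursion. *)
Lemma gauss_hermite p n : gauss (p * hermite n) = gauss p^`(n).
Proof.
elim: n p => [|n IHn] p; first by rewrite mulr1.
rewrite [hermite _]/= mulrBr mulrCA gaussB [gauss ('X * _)]gauss_stein.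
rewrite -[Ex _ _]/(gauss (p * hermite n)^`()) derivM -gaussB addrK.
by rewrite IHn derivSn.
Qed.

Lemma gauss_hermite_orth m n :
  gauss (hermite m * hermite n) = if m == n then n`!%:R else 0.
Proof.
wlog : m n / (m <= n)%N => [H|mn].
  have [/H //|/ltnW /H] := leqP m n.
  by rewrite mulrC eq_sym => ->; case: eqP => // ->.
rewrite gauss_hermite derivn_hermite gaussZ.
case: eqP => [->|/eqP mn']; first by rewrite ffactnn subnn gauss1 mulr1.
by rewrite ffact_small ?mul0r// ltn_neqAle mn' mn.
Qed.

End Hermite.

(** * The proximity graph *)

Section Uniform.
Context (R : realType).
Local Notation mu := (@lebesgue_measure R).
Local Notation Unif := (uniform_prob (@ltr01 R)).

Lemma uniform_pdf01_le1 (x : R) : uniform_pdf 0 1 x <= 1.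
Proof. by rewrite /uniform_pdf subr0 invr1; case: ifP. Qed.

Lemma near_itvE (x h : R) : [set y | `|x - y| <= h] = `[x - h, x + h]%classic.
Proof.
by apply/seteqP; split => y; rewrite /= in_itv /= ler_distlC.
Qed.

Lemma uniform_itv_le (a b : R) : a <= b -> (Unif `[a, b] <= (b - a)%:E)%E.
Proof.
move=> ab.
apply: (@le_trans _ _ (\int[mu]_(x in `[a, b]) 1)%E).
  apply: ge0_le_integral => //=.
  - by move=> x _; rewrite lee_fin uniform_pdf_ge0.
  - apply/measurable_EFinP; apply: measurable_funTS.
    exact: measurable_uniform_pdf.
  - by move=> x _; rewrite lee_fin uniform_pdf01_le1.
rewrite integral_cst//= lebesgue_measure_itv /= lte_fin mul1e.
by case: ltP => //; rewrite lee_fin subr_ge0.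
Qed.

Lemma uniform_itvE (a b : R) : 0 <= a -> a <= b -> b <= 1 ->
  Unif `[a, b] = (b - a)%:E.
Proof.
move=> a0 ab b1.
rewrite /uniform_prob (eq_integral (cst 1%E)); last first.
  move=> x; rewrite inE /= in_itv /= => /andP[ax xb].
  by rewrite /uniform_pdf subr0 invr1 (le_trans a0 ax) (le_trans xb b1).
rewrite integral_cst//= lebesgue_measure_itv /= lte_fin mul1e.
case: ltP => // ba; have -> : a = b by apply/eqP; rewrite eq_le ab.
by rewrite subrr.
Qed.

End Uniform.

Section Proximity.
Context d (T : measurableType d) (R : realType) (P : probability T R).
Variables (n : nat) (h : R).
Variables (V : 'I_n -> {RV P >-> R}) (E : 'I_n * 'I_n -> {RV P >-> R}).
Hypothesis V_indep : mutually_independent V.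
Hypothesis V_unif : forall (i : 'I_n) (A : set R), measurable A ->
  distribution P (V i) A = uniform_prob (@ltr01 R) A.
Hypothesis E_indep : mutually_independent E.
Hypothesis EV_indep : independent_families E V.
Hypothesis h0 : 0 <= h.
Notation edge := ('I_n * 'I_n)%type.
Implicit Types (S : {set edge}) (W : {set 'I_n}).

Definition close_event S : set T :=
  \bigcap_(e in [set` S]) [set w | `|V e.1 w - V e.2 w| <= h].

Definition close_prob S : R := fine (P (close_event S)).

Let Z := sum_RV E V.
Let indZ : mutually_independent Z := mutually_independent_sum E_indep V_indep EV_indep.

(* Noise and positions are merged into one independent family indexed by
   [edge + 'I_n]; [positions W] indexes the positions of the vertices in [W]. *)
Definition positions W : {set edge + 'I_n} := (inr @: W)%SET.

Let mem_positions W i : (inr i \in positions W) = (i \in W).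
Proof. by rewrite finset.mem_imset//; exact: inr_inj. Qed.

Lemma close_event_adapted S W : (forall e, e \in S -> inside W e) ->
  <<s cylinders Z (positions W) >> (close_event S).
Proof.
move=> SW.
apply: (@fin_bigcap_measurable _ (g_sigma_algebraType (cylinders Z (positions W)))) => //.
move=> e /= /SW /andP[e1 e2].
have -> : [set w | `|V e.1 w - V e.2 w| <= h] =
    (fun w => `|Z (inr e.1) w - Z (inr e.2) w|) @^-1` `]-oo, h]%classic.
  by apply/seteqP; split => w /=; rewrite in_itv.
apply: adapted_preimage => //.
apply: measurableT_comp => //; apply: measurable_funB.
  by apply: adapted_RV; rewrite mem_positions.
by apply: adapted_RV; rewrite mem_positions.
Qed.

Lemma measurable_close_event S : measurable (close_event S).
Proof.
apply: fin_bigcap_measurable => // e _.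
have mf : measurable_fun setT (fun w => `|V e.1 w - V e.2 w|).
  by apply: measurableT_comp => //; apply: measurable_funB; exact: measurable_funPT.
have -> : [set w | `|V e.1 w - V e.2 w| <= h] =
    (fun w => `|V e.1 w - V e.2 w|) @^-1` `]-oo, h]%classic.
  by apply/seteqP; split => w /=; rewrite in_itv.
by rewrite -[X in measurable X]setTI; exact: mf.
Qed.

Lemma close_prob_ge0 S : 0 <= close_prob S.
Proof. by rewrite fine_ge0. Qed.

Let close_probE S : (close_prob S)%:E = P (close_event S).
Proof. by rewrite fineK// fin_num_measure//; exact: measurable_close_event. Qed.

Lemma close_prob_set0 : close_prob finset.set0 = 1.
Proof.
rewrite /close_prob; have -> : close_event finset.set0 = setT.
  by rewrite -subTset => w _ e /=; rewrite inE.
by rewrite probability_setT.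
Qed.

Lemma close_prob_mono S S' : S \subset S' -> close_prob S' <= close_prob S.
Proof.
move=> SS'; rewrite -lee_fin !close_probE; apply: le_measure; rewrite ?inE;
  try exact: measurable_close_event.
by move=> w S'w e /= eS; apply: S'w; exact: (fintype.subsetP SS').
Qed.

Lemma close_eventU1 e S :
  close_event (e |: S)%SET = close_event S `&` [set w | `|V e.1 w - V e.2 w| <= h].
Proof.
apply/seteqP; split => [w Sw|w [Sw ew] f] /=.
  by split => [f fS|]; apply: Sw; rewrite /= !inE ?eqxx ?[_ \in S]fS ?orbT.
by rewrite !inE => /predU1P[->//|fS]; exact: Sw.
Qed.

Let xh (x : R) : x - h <= x + h.
Proof. by rewrite lerBlDr -addrA lerDl addr_ge0. Qed.

Let hE (x : R) : x + h - (x - h) = 2 * h.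
Proof. ring. Qed.

(** Given the positions in [W], the endpoint outside is still uniform and has to fall into an
    interval of length [2 * h]. *)
Lemma close_prob_grow S W e : (forall f, f \in S -> inside W f) ->
  crossing W e -> close_prob (e |: S)%SET <= 2 * h * close_prob S.
Proof.
move=> SW eW; rewrite -lee_fin EFinM !close_probE close_eventU1.
have aS := close_event_adapted SW.
have mS := measurable_close_event S.
wlog [e1 e2] : e {eW} / e.1 \in W /\ e.2 \notin W.
  move=> H; move: eW; rewrite /crossing.
  have [e1|e1] := boolP (e.1 \in W); have [e2|e2] := boolP (e.2 \in W) => // _.
    exact: H.
  have := H (e.2, e.1); rewrite /= => /(_ (conj e2 e1)).
  by under eq_set do rewrite distrC.
have w1 : inr e.1 \in positions W by rewrite mem_positions.
have w2 : inr e.2 \notin positions W by rewrite mem_positions.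
rewrite (near_law indZ h aS w1 w2).
apply: (@le_trans _ _ (\int[P]_(t in close_event S) (2 * h)%:E)%E); last first.
  by rewrite integral_cst.
apply: ge0_le_integral => //.
- apply: measurable_funTS.
  exact: (measurableT_comp (measurable_near (Z (inr e.2)) h)).
- move=> t _; move: (Z (inr e.1) t) => x.
  rewrite near_itvE [distribution _ _ _](V_unif e.2)//.
  by apply: le_trans (uniform_itv_le (xh x)) _; rewrite lee_fin hE.
Qed.

Lemma close_prob_split S S' W : (forall f, f \in S -> inside W f) ->
  (forall f, f \in S' -> inside (~: W)%SET f) ->
  close_prob (S :|: S')%SET = close_prob S * close_prob S'.
Proof.
move=> SW S'W; apply: EFin_inj; rewrite EFinM !close_probE.
rewrite -(mutually_independent_cylinders indZ (J := positions W)
  (K := positions (~: W)%SET)).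
- congr (P _); apply/seteqP; split => [w Sw|w [Sw S'w] f] /=.
    by split => f fS; apply: Sw; rewrite /= inE; apply/orP; [left|right].
  by rewrite inE => /orP[fS|fS]; [exact: Sw|exact: S'w].
- rewrite finset.disjoints_subset; apply/fintype.subsetP => _ /imsetP[x xW ->].
  by rewrite inE mem_positions inE negbK.
- exact: close_event_adapted.
- exact: close_event_adapted.
Qed.

(** Only positions [V i] in [[h, 1 - h]] are kept: they have probability [1 - 2h], and the interval
    around them lies within [[0, 1]], so it has probability exactly [2h]. *)
Lemma close_prob1_ge (i j : 'I_n) : i != j -> h <= 1 / 2 ->
  2 * h - 4 * h ^+ 2 <= close_prob [set (i, j)]%SET.
Proof.
move=> ij h2; rewrite -lee_fin close_probE.
have -> : close_event [set (i, j)]%SET =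
    setT `&` [set w | `|Z (inr i) w - Z (inr j) w| <= h].
  rewrite setTI; apply/seteqP; split => [w Sw|w ew e] /=.
    by apply: (Sw (i, j)); rewrite /= inE.
  by rewrite inE => /eqP ->.
have wi : inr i \in positions [set i]%SET by rewrite mem_positions inE.
have wj : inr j \notin positions [set i]%SET.
  by rewrite mem_positions inE eq_sym.
rewrite (near_law indZ h _ wi wj); last first.
  exact: (@measurableT _ (g_sigma_algebraType (cylinders Z _))).
pose G := V i @^-1` `[h, 1 - h]%classic.
have mG : measurable G by exact: measurable_funPTI.
apply: (@le_trans _ _ (\int[P]_t ((2 * h)%:E * (\1_G t)%:E))%E).
  rewrite integralZl//; last exact: integrable_indic.
  have PG : P G = (1 - h - h)%:E.
    rewrite -[LHS]/(distribution P (V i) `[h, (1 - h)%R]%classic) V_unif//.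
    have hh : h <= 1 - h by rewrite lerBrDr -mulr2n -mulr_natl -ler_pdivlMl// mulrC.
    by rewrite uniform_itvE// lerBlDr lerDl.
  have -> : (\int[P]_x (\1_G x)%:E)%E = (1 - h - h)%:E.
    by rewrite integral_indic// setIT; exact: PG.
  rewrite -EFinM lee_fin.
  rewrite le_eqVlt; apply/orP; left; apply/eqP; ring.
apply: ge0_le_integral => //.
- by move=> t _; rewrite mule_ge0// lee_fin mulr_ge0.
- by apply: measurable_funeM; apply/measurable_EFinP; exact: measurable_indic.
- exact: (measurableT_comp (measurable_near (Z (inr j)) h)).
move=> t _; rewrite indicE; case: (boolP (t \in G)) => [|_]; last first.
  by rewrite mule0.
rewrite inE /G /= in_itv /= => /andP[ht th].
rewrite mule1; move: (V i t) ht th => x ht th.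
rewrite near_itvE [distribution _ _ _](V_unif j)// uniform_itvE ?xh ?subr_ge0//.
  by rewrite lee_fin hE.
by rewrite -lerBrDr.
Qed.

End Proximity.

(** * Hermite expansion of the observation *)

Section Observation.
Context d (T : measurableType d) (R : realType) (P : probability T R).
Variables (n D : nat) (h lam : R).
Variables (V : 'I_n -> {RV P >-> R}) (E : 'I_n * 'I_n -> {RV P >-> R}).
Hypothesis V_indep : mutually_independent V.
Hypothesis E_indep : mutually_independent E.
Hypothesis E_normal : forall (e : 'I_n * 'I_n) (A : set R), measurable A ->
  distribution P (E e) A = normal_prob 0 1 A.
Hypothesis EV_indep : independent_families E V.
Notation edge := ('I_n * 'I_n)%type.
Notation multi := {ffun edge -> 'I_D.+1}.
Notation close_event := (close_event h V).
Notation close_prob := (close_prob h V).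
Implicit Types (a b c : multi) (S : {set edge}) (e : edge).

Let Z := sum_RV E V.
Let indZ : mutually_independent Z := mutually_independent_sum E_indep V_indep EV_indep.

(* `R` carries two measurable structures with the same sets; `normal_prob`
   lives on `measurableTypeR R`. *)
Lemma measurable_noise e : @measurable_fun _ _ T (measurableTypeR R) setT (E e).
Proof.
have mE : measurable_fun setT (E e) by exact: measurable_funPT.
by move=> mD B mB; exact: (mE measurableT B mB).
Qed.

Lemma ge0_integral_noise e (f : R -> \bar R) :
  measurable_fun setT f -> (forall x, (0 <= f x)%E) ->
  (\int[P]_w f (E e w) = \int[normal_prob 0 1]_x f x)%E.
Proof.
move=> mf f0.
have /= <- := @ge0_integral_pushforward _ _ T (measurableTypeR R) R (E e)
  (measurable_noise e) P setT f measurableT mf (fun x _ => f0 x).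
apply: eq_measure_integral => [|mE A mA _]; first exact: (measurable_noise e).
exact: E_normal.
Qed.

Lemma integral_noise e (f : R -> \bar R) :
  measurable_fun setT f -> P.-integrable setT (f \o E e) ->
  (\int[P]_w f (E e w) = \int[normal_prob 0 1]_x f x)%E.
Proof.
move=> mf fi.
have /= <- := @integral_pushforward _ _ T (measurableTypeR R) R (E e)
  (measurable_noise e) P setT f mf fi measurableT.
apply: eq_measure_integral => [|mE A mA _]; first exact: (measurable_noise e).
exact: E_normal.
Qed.

Lemma finite_moments_noise e : finite_moments P (E e).
Proof.
split => [|k]; first exact: measurable_funPT.
have mk : measurable_fun setT (fun x : R => `|x| ^+ k).
  by apply: measurable_funX; exact: normr_measurable.
have [_ /(_ k)/integrableP[_]] := finite_moments_normal_id R.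
rewrite -(ge0_integral_noise e)//; last first.
  by apply: measurableT_comp => //; exact/measurable_EFinP.
move=> fi; apply/integrableP; split => //.
by apply/measurable_EFinP/measurable_funX/measurableT_comp.
Qed.

Lemma finite_moments_noise_horner e (p : {poly R}) :
  finite_moments P (fun w => p.[E e w]).
Proof. exact: finite_moments_horner (finite_moments_noise e). Qed.

Lemma Ex_noise_horner e (p : {poly R}) : Ex P (fun w => p.[E e w]) = gauss p.
Proof.
rewrite /Ex /gauss /Ex /Rintegral; congr fine.
apply: (integral_noise (f := fun x => (p.[x])%:E)).
  by apply/measurable_EFinP; exact: measurable_poly.
exact: finite_moments_integrable (finite_moments_noise_horner e p).
Qed.

(** [U] depends on the positions alone, so it separates from the noise, whose entries then separate
    from each other. *)
Lemma Ex_noise_prod (U : T -> R) (p : edge -> {poly R}) :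
  adapted Z (positions finset.setT) U -> finite_moments P U ->
  Ex P (fun w => U w * \prod_e (p e).[E e w]) = Ex P U * \prod_e gauss (p e).
Proof.
move=> aU fU.
(* Only noise indices occur in [r]; the value [1] at a position is a filler. *)
pose F (s : edge + 'I_n) : T -> R :=
  if s is inl e then fun w => (p e).[E e w] else fun=> 1.
pose r : seq (edge + 'I_n) := [seq inl e | e <- index_enum edge].
have rP s : s \in r -> exists e, s = inl e.
  by move=> /mapP[e _ ->]; exists e.
have := @Ex_adapted_prod _ _ _ P _ Z indZ r (positions finset.setT) U F.
rewrite (_ : (fun w => U w * \prod_(s <- r) F s w) =
  fun w => U w * \prod_e (p e).[E e w]); last first.
  by apply/funext => w; rewrite big_map.
move=> ->//.
- congr (_ * _); rewrite big_map; apply: eq_bigr => e _ /=.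
  exact: Ex_noise_horner.
- by rewrite map_inj_uniq ?index_enum_uniq//; exact: inl_inj.
- by move=> _ /rP[e ->]; apply/negP => /imsetP[].
- move=> _ /rP[e ->] /=; apply: measurableT_comp; first exact: measurable_poly.
  exact: (@adapted_RV _ _ _ P _ Z [set inl e]%SET (inl e) (finset.set11 _)).
- by case=> [e|x]; [exact: finite_moments_noise_horner|exact: finite_moments_cst].
Qed.

Lemma close_eventI S S' :
  close_event S `&` close_event S' = close_event (S :|: S')%SET.
Proof.
apply/seteqP; split => [w [Sw S'w] e|w Sw] /=.
  by rewrite inE => /orP[eS|eS]; [exact: Sw|exact: S'w].
by split => e eS; apply: Sw; rewrite /= inE; apply/orP; [left|right].
Qed.

Let mclose S : measurable (close_event S).
Proof. exact: measurable_close_event. Qed.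

Lemma Ex_close S : Ex P \1_(close_event S) = close_prob S.
Proof. exact: Ex_indic (mclose S). Qed.

Lemma finite_moments_close S : finite_moments P \1_(close_event S).
Proof.
have mS := mclose S.
apply: (@finite_moments_bounded _ _ _ _ _ 1); first exact: measurable_indic.
by move=> w; rewrite indicE normr_nat; case: (_ \in _).
Qed.

Lemma adapted_close S : adapted Z (positions finset.setT) (\1_(close_event S) : T -> R).
Proof.
have mS : <<s cylinders Z (positions finset.setT) >> (close_event S).
  by apply: close_event_adapted => e _; rewrite /inside !inE.
by apply: measurable_indic.
Qed.

Definition signal_entry e (w : T) : R :=
  if `|V e.1 w - V e.2 w| <= h then lam else 0.

Lemma signal_entryE e w :
  signal_entry e w = lam * \1_(close_event [set e]%SET) w.
Proof.
rewrite /signal_entry indicE; case: ifPn => [ew|ew].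
  by rewrite mem_set ?mulr1// => f /=; rewrite inE => /eqP ->.
rewrite memNset ?mulr0// => /(_ e) /=; rewrite inE eqxx => /(_ isT).
by rewrite (negbTE ew).
Qed.

Lemma prod_signal b c w :
  \prod_e signal_entry e w ^+ (b e - c e) =
  lam ^+ (\sum_e (b e - c e)) * \1_(close_event (mdiff b c)) w.
Proof.
rewrite indicE; case: (boolP (w \in _)) => [/set_mem bw|bw].
  rewrite mulr1 expr_sum; apply: eq_bigr => e _.
  have [cb|bc] := ltnP (c e) (b e).
    by rewrite /signal_entry (bw e) //= inE.
  by move: bc; rewrite -subn_eq0 => /eqP ->; rewrite !expr0.
have [e eb ew] : exists2 e, (c e < b e)%N & ~~ (`|V e.1 w - V e.2 w| <= h).
  apply: contrapT => H; move/negP: bw; apply; rewrite inE => e /=.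
  rewrite inE => eb; apply: contrapT => /negP ew; apply: H; by exists e.
rewrite mulr0 (bigD1 e)//= {1}/signal_entry (negbTE ew) expr0n.
by rewrite subn_eq0 leqNgt eb mul0r.
Qed.

Definition hermite_noise c w : R := \prod_e (hermite R (c e)).[E e w].

Definition hermite_obs b w : R :=
  \prod_e (hermite R (b e)).[signal_entry e w + E e w].

Lemma hermite_obsE b w : hermite_obs b w =
  \sum_c (mbin b c)%:R * (lam ^+ (mdegree b - mdegree c) *
    \1_(close_event (mdiff b c)) w) * hermite_noise c w.
Proof.
rewrite /hermite_obs.
(* The sums over [c e <= b e] are widened to the common index type ['I_D.+1], so that the product of
   sums can be distributed into a sum over multi-indices. *)
under eq_bigr => e _.
  rewrite hermiteD (big_ord_widen D.+1 (fun k =>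
    'C(b e, k)%:R * signal_entry e w ^+ (b e - k) * (hermite R k).[E e w])) ?ltn_ord//.
  over.
under eq_bigr do rewrite big_mkcond /=.
rewrite (bigA_distr_bigA (fun e (k : 'I_D.+1) => if (k < (b e).+1)%N then
  'C(b e, k)%:R * signal_entry e w ^+ (b e - k) * (hermite R k).[E e w] else 0)) /=.
apply: eq_bigr => c _.
have [cb|cb] := boolP (mle c b); last first.
  rewrite mbin_small// !mul0r; move: cb; rewrite negb_forall => /existsP[e].
  by rewrite -ltnNge => cb; rewrite (bigD1 e)//= ltnNge cb /= mul0r.
have cb' e : (c e <= b e)%N by have /forallP := cb.
under eq_bigr do rewrite ltnS cb'.
rewrite !big_split /= -/(hermite_noise c w) -natr_prod prod_signal.
congr (_ * (_ ^+ _ * _) * _).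
rewrite /mdegree -[in RHS](eq_bigr _ (fun e _ => subnK (cb' e))).
by rewrite big_split /= addnK.
Qed.

Lemma finite_moments_hermite_noise c : finite_moments P (hermite_noise c).
Proof. by apply: finite_moments_prod => e _; exact: finite_moments_noise_horner. Qed.

Lemma Ex_close_hermite2 S c a :
  Ex P (fun w => \1_(close_event S) w * (hermite_noise c w * hermite_noise a w)) =
  close_prob S * (if c == a then (mfact a)%:R else 0).
Proof.
transitivity (Ex P (fun w => \1_(close_event S) w *
    \prod_e (hermite R (c e) * hermite R (a e)).[E e w])).
  congr Ex; apply/funext => w; congr (_ * _); rewrite -big_split /=.
  by apply: eq_bigr => e _; rewrite hornerM.
rewrite Ex_noise_prod ?Ex_close//; last 2 first.
- exact: adapted_close.
- exact: finite_moments_close.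
congr (_ * _); under eq_bigr do rewrite gauss_hermite_orth.
case: eqP => [->|/eqP ca].
  by rewrite /mfact natr_prod; apply: eq_bigr => e _; rewrite eqxx.
have [e cae] : exists e, c e != a e :> nat.
  apply/existsP; rewrite -negb_forall; apply: contra ca => /forallP ca.
  by apply/eqP/ffunP => e; apply/val_inj/eqP; exact: ca.
by rewrite (bigD1 e)//= (negbTE cae) mul0r.
Qed.

Lemma hermite_noise0 w : hermite_noise [ffun=> ord0] w = 1.
Proof. by rewrite /hermite_noise big1// => e _; rewrite ffunE hornerE. Qed.

Lemma Ex_close_hermite S c :
  Ex P (fun w => \1_(close_event S) w * hermite_noise c w) =
  close_prob S * (c == [ffun=> ord0])%:R.
Proof.
transitivity (Ex P (fun w => \1_(close_event S) w *
    (hermite_noise c w * hermite_noise [ffun=> ord0] w))).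
  by congr Ex; apply/funext => w; rewrite hermite_noise0 mulr1.
rewrite Ex_close_hermite2; congr (_ * _); case: eqP => // _.
by rewrite /mfact big1// => e _; rewrite ffunE.
Qed.

End Observation.

(** * The dual function and the error on a single entry *)

Section LowDegree.
Context d (T : measurableType d) (R : realType) (P : probability T R).
Variables (n D : nat) (h lam : R).
Variables (V : 'I_n -> {RV P >-> R}) (E : 'I_n * 'I_n -> {RV P >-> R}).
Hypothesis V_indep : mutually_independent V.
Hypothesis V_unif : forall (i : 'I_n) (A : set R), measurable A ->
  distribution P (V i) A = uniform_prob (@ltr01 R) A.
Hypothesis E_indep : mutually_independent E.
Hypothesis E_normal : forall (e : 'I_n * 'I_n) (A : set R), measurable A ->
  distribution P (E e) A = normal_prob 0 1 A.
Hypothesis EV_indep : independent_families E V.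
Hypotheses (h0 : 0 <= h) (lam0 : 0 <= lam).
Variables (i j : 'I_n).
Hypothesis ij : i != j.
Notation edge := ('I_n * 'I_n)%type.
Notation multi := {ffun edge -> 'I_D.+1}.
Notation close_event := (close_event h V).
Notation close_prob := (close_prob h V).
Notation signal_entry := (signal_entry h lam V).
Notation hermite_noise := (hermite_noise E).
Notation hermite_obs := (hermite_obs h lam V E).
Notation diff_moment := (diff_moment lam close_prob).
Notation cross_moment := (cross_moment lam i j close_prob).
Notation kappa := (kappa lam i j close_prob).
Implicit Types (a b c : multi) (S : {set edge}) (e : edge).

(* The function of the noise which has the same correlation as the signal entry
   [(i, j)] with every polynomial of degree at most [D] in the observation. *)
Definition dual_obs (w : T) : R :=
  \sum_(a : multi | (mdegree a <= D)%N)
     kappa a / (mfact a)%:R * hermite_noise a w.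

Let fm_noise c : finite_moments P (hermite_noise c).
Proof. exact: (finite_moments_hermite_noise E_normal). Qed.

Let fm_close S : finite_moments P \1_(close_event S).
Proof. exact: finite_moments_close. Qed.

Let Ex_close1 S c : Ex P (fun w => \1_(close_event S) w * hermite_noise c w) =
  close_prob S * (c == [ffun=> ord0])%:R.
Proof. exact: Ex_close_hermite. Qed.

Let Ex_close2 S c a :
  Ex P (fun w => \1_(close_event S) w * (hermite_noise c w * hermite_noise a w)) =
  close_prob S * (if c == a then (mfact a)%:R else 0).
Proof. exact: Ex_close_hermite2. Qed.

Lemma finite_moments_dual : finite_moments P dual_obs.
Proof.
apply: finite_moments_sum => a _.
by apply: finite_momentsM; [exact: finite_moments_cst|exact: fm_noise].
Qed.

Lemma finite_moments_signal e : finite_moments P (signal_entry e).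
Proof.
apply: (eq_finite_moments (fun w => esym (signal_entryE h lam V e w))).
by apply: finite_momentsM; [exact: finite_moments_cst|exact: fm_close].
Qed.

Lemma finite_moments_obs e :
  finite_moments P (fun w => signal_entry e w + E e w).
Proof.
apply: finite_momentsD; first exact: finite_moments_signal.
exact: (finite_moments_noise E_normal).
Qed.

Lemma finite_moments_hermite_obs b : finite_moments P (hermite_obs b).
Proof.
apply: finite_moments_prod => e _.
exact: finite_moments_horner (finite_moments_obs e).
Qed.

(** The signal is independent of the noise, so only the constant Hermite term [c = 0] of the
    expansion survives; it carries [X^b]. *)
Lemma Ex_obs_signal b :
  Ex P (fun w => hermite_obs b w * signal_entry (i, j) w) = cross_moment b.
Proof.
pose z : multi := [ffun=> ord0].
transitivity (Ex P (fun w => \sum_c ((mbin b c)%:R *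
    lam ^+ (mdegree b - mdegree c) * lam) *
    (\1_(close_event ((i, j) |: mdiff b c)%SET) w * hermite_noise c w))).
  congr Ex; apply/funext => w; rewrite hermite_obsE mulr_suml.
  apply: eq_bigr => c _; rewrite signal_entryE -close_eventI indicI /=.
  by move: (\1__ w) (\1__ w) (hermite_noise c w) (lam ^+ _) => *; ring.
rewrite Ex_sum; last first.
  move=> c _; apply: finite_momentsM; first exact: finite_moments_cst.
  by apply: finite_momentsM; [exact: fm_close|exact: fm_noise].
rewrite (bigD1 z) //= [X in _ + X]big1 ?addr0; last first.
  move=> c cz; rewrite ExZ; last first.
    by apply: finite_momentsM; [exact: fm_close|exact: fm_noise].
  rewrite Ex_close1.
  by rewrite (negbTE cz) !mulr0.
rewrite ExZ; last by apply: finite_momentsM; [exact: fm_close|exact: fm_noise].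
rewrite Ex_close1 eqxx mulr1.
have -> : mdegree z = 0%N by rewrite /mdegree big1// => e _; rewrite ffunE.
have -> : mbin b z = 1%N by rewrite /mbin big1// => e _; rewrite ffunE bin0.
rewrite mul1r subn0 -exprSr /cross_moment; congr (_ * close_prob _).
by apply/finset.setP => e; rewrite !inE ffunE.
Qed.

(** Orthogonality pairs each [a] with [c = a] only, and [a!] cancels the normalisation; the
    resulting sum is [cross_moment_kappa]. Every [a] below [b] is available in [dual_obs] because
    the degree of [b] is at most [D]. *)
Lemma Ex_obs_dual b : (mdegree b <= D)%N ->
  Ex P (fun w => hermite_obs b w * dual_obs w) = cross_moment b.
Proof.
move=> bD.
pose t c a w := ((mbin b c)%:R * lam ^+ (mdegree b - mdegree c) *
    (kappa a / (mfact a)%:R)) *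
    (\1_(close_event (mdiff b c)) w * (hermite_noise c w * hermite_noise a w)).
transitivity (Ex P (fun w => \sum_(a : multi | (mdegree a <= D)%N)
    \sum_(c : multi) t c a w)).
  congr Ex; apply/funext => w; rewrite /dual_obs mulr_sumr; apply: eq_bigr => a _.
  rewrite hermite_obsE mulr_suml; apply: eq_bigr => c _.
  rewrite /t; move: (kappa a / _) (hermite_noise a w) (hermite_noise c w).
  by move: (_ ^+ _) (\1_(_) w) => *; ring.
have fm c a : finite_moments P (fun w => \1_(close_event (mdiff b c)) w *
    (hermite_noise c w * hermite_noise a w)).
  by apply: finite_momentsM; [exact: fm_close|apply: finite_momentsM; exact: fm_noise].
have ft c a : finite_moments P (t c a).
  by apply: finite_momentsM; [exact: finite_moments_cst|exact: fm].
rewrite Ex_sum; last by move=> a _; exact: finite_moments_sum.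
rewrite cross_moment_kappa; last exact: close_prob_set0.
rewrite (bigID (fun a => mle a b)) /= [X in _ + X]big1 ?addr0; last first.
  move=> a /andP[_ ab]; rewrite Ex_sum// big1// => c _; rewrite ExZ//.
  rewrite Ex_close2.
  by case: eqP => [->|_]; rewrite ?mulr0// mbin_small// !mul0r.
apply: eq_big => [a|a /andP[_ ab]].
  apply/andP/idP => [[]//|ab]; split => //.
  exact: leq_trans (mle_degree ab) bD.
rewrite Ex_sum// (bigD1 a)//= [X in _ + X]big1 ?addr0; last first.
  move=> c ca; rewrite ExZ//.
  rewrite Ex_close2.
  by rewrite (negbTE ca) !mulr0.
rewrite ExZ// Ex_close2 eqxx /diff_moment.
have a0 : (mfact a)%:R != 0 :> R.
  by rewrite pnatr_eq0 -lt0n prodn_gt0// => e; exact: fact_gt0.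
move: (mfact a)%:R a0 (lam ^+ _) (close_prob _) (kappa a) (mbin b a)%:R.
by move=> x x0 *; field.
Qed.

Lemma Ex_dual_sqr : Ex P (fun w => dual_obs w ^+ 2) =
  \sum_(a : multi | (mdegree a <= D)%N) kappa a ^+ 2 / (mfact a)%:R.
Proof.
(* The indicator of the sure event is inserted to bring the products into the form of
   [Ex_close2]. *)
pose t c a w := (kappa c / (mfact c)%:R * (kappa a / (mfact a)%:R)) *
    (\1_(close_event finset.set0) w * (hermite_noise c w * hermite_noise a w)).
have e0 : close_event finset.set0 = setT.
  by rewrite -subTset => w _ e /=; rewrite inE.
have fm c a : finite_moments P (fun w => \1_(close_event finset.set0) w *
    (hermite_noise c w * hermite_noise a w)).
  by apply: finite_momentsM; [exact: fm_close|apply: finite_momentsM; exact: fm_noise].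
have ft c a : finite_moments P (t c a).
  by apply: finite_momentsM; [exact: finite_moments_cst|exact: fm].
transitivity (Ex P (fun w => \sum_(a : multi | (mdegree a <= D)%N)
    \sum_(c : multi | (mdegree c <= D)%N) t c a w)).
  congr Ex; apply/funext => w; rewrite expr2 /dual_obs mulr_sumr; apply: eq_bigr => a _.
  rewrite mulr_suml; apply: eq_bigr => c _.
  by rewrite /t e0 indicT /= mul1r mulrACA.
rewrite Ex_sum; last by move=> a _; exact: finite_moments_sum.
apply: eq_bigr => a aD; rewrite Ex_sum// (bigD1 a)//= [X in _ + X]big1 ?addr0; last first.
  move=> c /andP[_ ca]; rewrite ExZ//.
  rewrite Ex_close2.
  by rewrite (negbTE ca) !mulr0.
rewrite ExZ// Ex_close2 eqxx.
rewrite close_prob_set0 mul1r.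
have a0 : (mfact a)%:R != 0 :> R.
  by rewrite pnatr_eq0 -lt0n prodn_gt0// => e; exact: fact_gt0.
by move: (mfact a)%:R a0 (kappa a) => x x0 y; field.
Qed.

Let hermite_coef (k : nat) : exists c : nat -> R,
  'X^k = \sum_(l < k.+1) c l *: hermite R l.
Proof. by apply: hermite_span; rewrite size_polyXn. Qed.

Definition monomial_obs (k : edge -> nat) (w : T) : R :=
  \prod_e (signal_entry e w + E e w) ^+ k e.

Lemma finite_moments_monomial_obs (k : edge -> nat) :
  finite_moments P (monomial_obs k).
Proof.
apply: finite_moments_prod => e _; apply: finite_momentsX.
exact: finite_moments_obs.
Qed.

Lemma Ex_monomial_obs (k : edge -> nat) : (\sum_e k e <= D)%N ->
  Ex P (fun w => monomial_obs k w * signal_entry (i, j) w) =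
  Ex P (fun w => monomial_obs k w * dual_obs w).
Proof.
move=> kD.
have ke e : (k e <= D)%N by apply: leq_trans kD; rewrite (bigD1 e)//= leq_addr.
pose c l := sval (cid (hermite_coef l)).
have cE l : 'X^l = \sum_(m < l.+1) c l m *: hermite R m.
  by rewrite /c; case: cid.
(* The coefficients of the monomial in the Hermite basis. They vanish unless [b <= k], so only
   degrees up to [D] occur, where both correlations are known to agree. *)
pose C b := \prod_e (if (b e < (k e).+1)%N then c (k e) (b e) else 0).
have kE w : monomial_obs k w = \sum_b C b * hermite_obs b w.
  rewrite /monomial_obs.
  transitivity (\prod_e \sum_(l < D.+1) (if (l < (k e).+1)%N then
      c (k e) l else 0) * (hermite R l).[signal_entry e w + E e w]).
    apply: eq_bigr => e _; rewrite -hornerXn cE horner_sum.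
    rewrite (big_ord_widen D.+1
      (fun l => (c (k e) l *: hermite R l).[signal_entry e w + E e w])) ?ltnS//.
    rewrite big_mkcond /=; apply: eq_bigr => l _.
    by case: ifP => _; rewrite ?mul0r// hornerZ.
  rewrite (bigA_distr_bigA (fun e (l : 'I_D.+1) => (if (l < (k e).+1)%N then
      c (k e) l else 0) * (hermite R l).[signal_entry e w + E e w])) /=.
  by apply: eq_bigr => b _; rewrite big_split.
have C0 b : ~~ (mdegree b <= D)%N -> C b = 0.
  rewrite -ltnNge => bD; have [/forallP bk|] := boolP [forall e, (b e <= k e)%N].
    suff : (mdegree b <= D)%N by rewrite leqNgt bD.
    by apply: leq_trans kD; apply: leq_sum => e _; exact: bk.
  rewrite negb_forall => /existsP[e]; rewrite -ltnNge => ebk.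
  by rewrite /C (bigD1 e)//= ltnNge ebk /= mul0r.
have decomp U : finite_moments P U -> Ex P (fun w => monomial_obs k w * U w) =
    \sum_b C b * Ex P (fun w => hermite_obs b w * U w).
  move=> fU.
  have fb b : finite_moments P (fun w => hermite_obs b w * U w).
    by apply: finite_momentsM => //; exact: finite_moments_hermite_obs.
  transitivity (Ex P (fun w => \sum_b C b * (hermite_obs b w * U w))).
    congr Ex; apply/funext => w; rewrite kE mulr_suml.
    by apply: eq_bigr => b _; rewrite mulrA.
  rewrite Ex_sum => [|b _]; last first.
    by apply: finite_momentsM => //; exact: finite_moments_cst.
  by apply: eq_bigr => b _; rewrite ExZ.
rewrite !decomp; [|exact: finite_moments_dual|exact: finite_moments_signal].
apply: eq_bigr => b _; have [bD|/C0 ->] := boolP (mdegree b <= D)%N.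
  by rewrite Ex_obs_signal Ex_obs_dual.
by rewrite !mul0r.
Qed.

Definition poly_obs (p : mpoly.mpoly (n * n) R) (w : T) : R :=
  mpoly.meval
    (fun l => mxvec (\matrix_(a, b) (signal_entry (a, b) w + E (a, b) w)) 0 l) p.

Lemma poly_obsE p w : poly_obs p w = \sum_(m <- mpoly.msupp p)
  mpoly.mcoeff m p *
  monomial_obs (fun e => mpoly.fun_of_multinom m (uncurry (@mxvec_index n n) e)) w.
Proof.
rewrite /poly_obs mpoly.mevalE; apply: eq_bigr => m _; congr (_ * _).
rewrite (reindex _ (curry_mxvec_bij n n)) /=.
by apply: eq_bigr => -[a b] _; rewrite mxvecE mxE.
Qed.

Lemma finite_moments_poly_obs p : finite_moments P (poly_obs p).
Proof.
apply: (eq_finite_moments (fun w => esym (poly_obsE p w))).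
apply: finite_moments_sum => m _.
apply: finite_momentsM; first exact: finite_moments_cst.
exact: finite_moments_monomial_obs.
Qed.

Lemma Ex_poly_obs p : (mpoly.msize p <= D.+1)%N ->
  Ex P (fun w => poly_obs p w * signal_entry (i, j) w) =
  Ex P (fun w => poly_obs p w * dual_obs w).
Proof.
move=> pD.
pose k (m : mpoly.multinom (n * n)) (e : edge) :=
  mpoly.fun_of_multinom m (uncurry (@mxvec_index n n) e).
have decomp U : finite_moments P U -> Ex P (fun w => poly_obs p w * U w) =
    \sum_(m <- mpoly.msupp p) mpoly.mcoeff m p *
      Ex P (fun w => monomial_obs (k m) w * U w).
  move=> fU.
  have fm m : finite_moments P (fun w => monomial_obs (k m) w * U w).
    by apply: finite_momentsM => //; exact: finite_moments_monomial_obs.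
  transitivity (Ex P (fun w => \sum_(m <- mpoly.msupp p) mpoly.mcoeff m p *
      (monomial_obs (k m) w * U w))).
    congr Ex; apply/funext => w; rewrite poly_obsE mulr_suml.
    by apply: eq_bigr => m _; rewrite mulrA.
  rewrite Ex_sum => [|m _]; last first.
    by apply: finite_momentsM => //; exact: finite_moments_cst.
  by apply: eq_bigr => m _; rewrite ExZ.
rewrite !decomp; [|exact: finite_moments_dual|exact: finite_moments_signal].
apply: eq_big_seq => m mp; congr (_ * _); apply: Ex_monomial_obs.
rewrite -ltnS; apply: leq_trans pD; apply: leq_ltn_trans (mpoly.msize_mdeg_lt mp).
by rewrite mpoly.mdegE [leqRHS](reindex _ (curry_mxvec_bij n n)).
Qed.

(** With [c = 2 * h], the bound [E X_ij^2 >= lam^2 (c - c^2)] and the energy bound combine; the term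
    [lam^2 c^2] turns the [2] of the energy into [3]. *)
Lemma mse_entry_ge p : (mpoly.msize p <= D.+1)%N ->
  h <= 1 / 2 -> (2 * h) ^+ 2 * n%:R <= 1 / 2 ->
  let r0 := 2 * lam ^+ 2 * (D%:R + 1) ^+ 4 in r0 < 1 ->
  lam ^+ 2 * (2 * h) - lam ^+ 2 * (2 * h) ^+ 2 * (3 + 5 * r0 / (1 - r0)) <=
  Ex P (fun w => (poly_obs p w - signal_entry (i, j) w) ^+ 2).
Proof.
move=> pD h2 hn r0 r01.
have fp := finite_moments_poly_obs p.
have fX := finite_moments_signal (i, j).
have fg := finite_moments_dual.
have fN U : finite_moments P U -> finite_moments P (fun w => -2 * U w).
  by move=> fU; apply: finite_momentsM => //; exact: finite_moments_cst.
have sq U W : finite_moments P U -> finite_moments P W ->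
    Ex P (fun w => (U w - W w) ^+ 2) =
    Ex P (fun w => U w ^+ 2) + -2 * Ex P (fun w => U w * W w) +
    Ex P (fun w => W w ^+ 2).
  move=> fU fW.
  have fU2 := finite_momentsX 2 fU; have fW2 := finite_momentsX 2 fW.
  have fUW := finite_momentsM fU fW.
  rewrite -ExZ// -ExD//; last exact: fN.
  rewrite -ExD//; last by apply: finite_momentsD => //; exact: fN.
  by congr Ex; apply/funext => w; ring.
rewrite sq// Ex_poly_obs//.
have : 0 <= Ex P (fun w => (poly_obs p w - dual_obs w) ^+ 2).
  by apply: Ex_ge0 => w; exact: sqr_ge0.
rewrite sq// Ex_dual_sqr.
have X2 : lam ^+ 2 * (2 * h - 4 * h ^+ 2) <= Ex P (fun w => signal_entry (i, j) w ^+ 2).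
  have -> : Ex P (fun w => signal_entry (i, j) w ^+ 2) =
      lam ^+ 2 * close_prob [set (i, j)]%SET.
    have <- : Ex P \1_(close_event [set (i, j)]%SET) = close_prob [set (i, j)]%SET.
      exact: Ex_close.
    rewrite -ExZ//.
    congr Ex; apply/funext => w; rewrite signal_entryE exprMn indicE.
    by case: (_ \in _); rewrite ?expr1n ?expr0n.
  rewrite ler_wpM2l ?sqr_ge0//.
  exact: (close_prob1_ge V_indep V_unif E_indep EV_indep).
have energy : \sum_(a : multi | (mdegree a <= D)%N) kappa a ^+ 2 / (mfact a)%:R <=
    lam ^+ 2 * (2 * h) ^+ 2 * (2 + 5 * r0 / (1 - r0)).
  have pr0 := close_prob_ge0 h V.
  have pr1 := close_prob_set0 h V.
  have prm S S' : S \subset S' -> close_prob S' <= close_prob S.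
    exact: close_prob_mono.
  have prg S W e : (forall f, f \in S -> inside W f) -> crossing W e ->
      close_prob (e |: S)%SET <= 2 * h * close_prob S.
    exact: (close_prob_grow V_indep V_unif E_indep EV_indep).
  have prs S S' W : (forall f, f \in S -> inside W f) ->
      (forall f, f \in S' -> inside (~: W)%SET f) ->
      close_prob (S :|: S')%SET = close_prob S * close_prob S'.
    exact: (close_prob_split h V_indep E_indep EV_indep).
  apply: (kappa_energy ij) => //.
  - by move=> a; apply: kappa_not_joined.
  - by move=> a; apply: kappa_le; rewrite ?mulr_ge0.
move: X2 energy.
set K := \sum_(a | _) _; set X := Ex P (fun w => signal_entry _ w ^+ 2).
move: (Ex P _) (Ex P _) => A B.
have -> : lam ^+ 2 * (2 * h - 4 * h ^+ 2) =
    lam ^+ 2 * (2 * h) - lam ^+ 2 * (2 * h) ^+ 2 by ring.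
move: (lam ^+ 2 * (2 * h)) (lam ^+ 2 * (2 * h) ^+ 2) (5 * r0 / (1 - r0)) => u v s.
rewrite (_ : v * (3 + s) = v * (2 + s) + v); last ring.
move: (v * _) => z; lra.
Qed.

End LowDegree.

(** As [N (N - 1) / N^2 = 1 - 1 / N], the right side exceeds the left by the nonnegative term
    [4 l k^2 C / N]. *)
Lemma sum_entries_ge (R : realType) (N k l C : R) : 1 <= N -> 0 <= l -> 0 <= C ->
  2 * l * k * (N - 1) - 4 * l * k ^+ 2 * C <=
  N * (N - 1) * (l * (2 * (k / N)) - l * (2 * (k / N)) ^+ 2 * C).
Proof.
move=> N1 l0 C0; have N0 : 0 < N by exact: lt_le_trans N1.
have Nn0 : N != 0 by rewrite gt_eqF.
have -> : N * (N - 1) * (l * (2 * (k / N)) - l * (2 * (k / N)) ^+ 2 * C) =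
    2 * l * k * (N - 1) - 4 * l * k ^+ 2 * C + 4 * l * k ^+ 2 * C / N by field.
rewrite lerDl; apply: divr_ge0 (ltW N0); apply: mulr_ge0 => //.
by apply: mulr_ge0 (sqr_ge0 _); exact: mulr_ge0.
Qed.

Theorem theorem10 (R : realType) (d : measure_display) (T : measurableType d)
    (P : probability T R) (n k D : nat) (lambda : R)
    (V : 'I_n -> {RV P >-> R}) (E : 'I_n * 'I_n -> {RV P >-> R})
    (hn : (2 <= n)%N) (hk : (1 <= k)%N) (hD : (1 <= D)%N)
    (hlambda : 0 < lambda < 1)
    (V_indep : mutually_independent V)
    (V_unif : forall (i : 'I_n) (A : set R), measurable A ->
       distribution P (V i) A = uniform_prob (@ltr01 R) A)
    (E_indep : mutually_independent E)
    (E_normal : forall (ij : 'I_n * 'I_n) (A : set R), measurable A ->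
       distribution P (E ij) A = normal_prob 0 1 A)
    (EV_indep : independent_families E V) :
  let X := signal k lambda V in
  let Y := fun w : T => X w + noise E w in
  let r0 : R := 2 * lambda ^+ 2 * (D%:R + 1) ^+ 4 in
  r0 < 1 ->
  (2 * k%:R + 1) ^+ 2 <= n%:R / 2 :> R ->
  ((2 * lambda ^+ 2 * k%:R * (n%:R - 1)
    - 4 * lambda ^+ 2 * k%:R ^+ 2 * (3 + 5 * r0 / (1 - r0)))%:E
   <= mmse_le P D X Y)%E.
Proof.
move=> X Y r0 r01 hk2.
pose h : R := k%:R / n%:R.
have n0 : 0 < n%:R :> R by rewrite ltr0n; exact: ltnW hn.
have n1 : 1 <= n%:R :> R by rewrite ler1n; exact: ltnW hn.
have k1 : 1 <= k%:R :> R by rewrite ler1n.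
have h0 : 0 <= h by rewrite divr_ge0.
have lam0 : 0 <= lambda by case/andP: hlambda => /ltW.
(* The hypothesis gives [4 k^2 <= n / 2], hence both [k <= n / 2] and the ratio
   [4 k^2 / n <= 1 / 2]. *)
have h2 : h <= 1 / 2 by rewrite /h ler_pdivrMr//; nra.
have hn2 : (2 * h) ^+ 2 * n%:R <= 1 / 2.
  have -> : (2 * h) ^+ 2 * n%:R = 4 * k%:R ^+ 2 / n%:R.
    by rewrite /h; field; rewrite gt_eqF.
  rewrite ler_pdivrMr//; nra.
pose B := lambda ^+ 2 * (2 * h) -
  lambda ^+ 2 * (2 * h) ^+ 2 * (3 + 5 * r0 / (1 - r0)).
have r00 : 0 <= r0 by rewrite /r0 !mulr_ge0 ?exprn_ge0 ?addr_ge0.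
apply: (@le_trans _ _ (n%:R * (n%:R - 1) * B)%:E).
  rewrite lee_fin; apply: sum_entries_ge; rewrite ?sqr_ge0//.
  by rewrite addr_ge0// divr_ge0 ?mulr_ge0// subr_ge0 ltW.
apply: le_ereal_inf_tmp => _ [f fpoly <-].
pose p i j := sval (cid (fpoly i j)).
have pD i j : (mpoly.msize (p i j) <= D.+1)%N by rewrite /p; case: cid => ? [].
have fE i j Z : f Z i j = mpoly.meval (fun l => mxvec Z 0 l) (p i j).
  by rewrite /p; case: cid => ? [].
pose err i j w :=
  (poly_obs h lambda V E (p i j) w - signal_entry h lambda V (i, j) w) ^+ 2.
have ferr i j : finite_moments P (err i j).
  apply: (finite_momentsX 2); apply: finite_momentsD.
    exact: finite_moments_poly_obs.
  by apply: finite_momentsN; exact: finite_moments_signal.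
have -> : (fun w => frobenius (f (Y w) - X w) ^+ 2) =
    fun w => \sum_i \sum_j err i j w.
  apply/funext => w; rewrite sqr_sqrtr; last first.
    by apply: sumr_ge0 => i _; apply: sumr_ge0 => j _; exact: sqr_ge0.
  apply: eq_bigr => i _; apply: eq_bigr => j _.
  rewrite /err !mxE fE /poly_obs; congr ((mpoly.meval _ _ - _) ^+ 2).
  by apply/funext => l; congr (mxvec _ 0 l); apply/matrixP => a b; rewrite !mxE.
have fsum i : finite_moments P (fun w => \sum_j err i j w).
  exact: finite_moments_sum.
(* The error has finite expectation for every polynomial [f], so the inequality can be proved
   between real numbers. *)
rewrite unlock -[leRHS]fineK; last first.
  apply: integrable_fin_num => //.
  by apply: finite_moments_integrable; exact: finite_moments_sum.
rewrite lee_fin -[leRHS]/(Ex P (fun w => \sum_i \sum_j err i j w)).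
rewrite Ex_sum//; under eq_bigr do rewrite Ex_sum//.
(* Diagonal signal entries are the constant [lambda]; their error is only bounded below by zero,
   which leaves [n (n - 1)] entries. *)
apply: (@le_trans _ _ (\sum_(i < n) \sum_(j < n | j != i) B)).
  rewrite (eq_bigr (fun=> B *+ n.-1)) => [|i _]; last first.
    by rewrite sumr_const (cardC1 i) card_ord.
  rewrite sumr_const card_ord -mulrnA -[leRHS]mulr_natl natrM -subn1.
  by rewrite natrB ?(ltnW hn)// [(_ - 1) * _]mulrC.
apply: ler_sum => i _; rewrite [leRHS](bigD1 i)//= -[leLHS]add0r lerD//.
  by apply: Ex_ge0 => w; exact: sqr_ge0.
apply: ler_sum => j ji.
by apply: mse_entry_ge => //; rewrite eq_sym.
Qed.
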